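(* Let $1<p<\infty$ and let $\phi_1,\phi_2,\ldots,\phi_N\in(A^p)^*$ be linearly independent. Then a function $F\in A^p$ satisfies $$\|F\|_{A^p}=\inf\{\|f\|_{A^p}: f\in A^p,\ \phi_1(f)=\phi_1(F),\ldots,\phi_N(f)=\phi_N(F)\}$$ if and only if $\mathcal{P}(|F|^{p-1}\operatorname{sgn}F)$ is a linear combination of the kernels of $\phi_1,\ldots,\phi_N$.
   Context: $\mathbb{D}$ is the open unit disc in $\mathbb{C}$ and $\sigma$ is area measure normalized so that $\sigma(\mathbb{D})=1$. For $1<p<\infty$, $A^p$ is the Bergman space of analytic functions $f$ on $\mathbb{D}$ with $\|f\|_{A^p}=\left(\int_{\mathbb{D}}|f|^p\,d\sigma\right)^{1/p}<\infty$. With $1/p+1/q=1$, each $\phi\in(A^p)^*$ is represented by a unique $k\in A^q$ via $\phi(f)=\int_{\mathbb{D}}f\,\overline{k}\,d\sigma$, and $k$ is called the kernel of $\phi$. For $f\in L^1(\mathbb{D},\sigma)$ the Bergman projection is $(\mathcal{P}f)(z)=\int_{\mathbb{D}}\frac{f(\zeta)}{(1-\overline{\zeta}z)^2}\,d\sigma(\zeta)$; it maps $L^p$ boundedly onto $A^p$ for $1<p<\infty$. For complex $w\neq0$, $\operatorname{sgn}w=w/|w|$, and $\operatorname{sgn}0=0$. *)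

(* Defs.v *)
From HB Require Import structures.
From mathcomp Require Import all_boot all_order all_algebra.
From mathcomp Require Import all_classical all_reals all_analysis.
From mathcomp Require Import measurable_realfun.
From mathcomp Require Import complex.

Set Implicit Arguments.
Unset Strict Implicit.
Unset Printing Implicit Defensive.

Import Order.TTheory GRing.Theory Num.Theory.
Import numFieldNormedType.Exports.
Import Normc.

Local Open Scope classical_set_scope.
Local Open Scope ring_scope.
Local Open Scope complex_scope.

Section Disc.
Variable R : realType.

Definition disc : set R[i] := [set z | normc z < 1].

(* R[i] carries no measurable structure in the library: integrals over the
   complex plane are taken over R * R through the identification [plane]. *)
Definition R2 := (measurableTypeR R * measurableTypeR R)%type.

Definition plane (x : R2) : R[i] := (x.1 : R) +i* (x.2 : R).

Definition pdisc : set R2 := plane @^-1` disc.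

Definition area : {measure set R2 -> \bar R} :=
  (@lebesgue_measure R \x @lebesgue_measure R)%E.

Lemma inv_area_ge0 : 0 <= (fine (area pdisc))^-1.
Proof. by rewrite invr_ge0 fine_ge0. Qed.

(* Normalized on the disc, but not restricted to it: [sigma_pdisc] below shows
   that the disc has mass 1. *)
Definition sigma : {measure set R2 -> \bar R} :=
  mscale (NngNum inv_area_ge0) area.

Lemma pdiscE : pdisc = [set x | (x.1 : R) ^+ 2 + (x.2 : R) ^+ 2 < 1].
Proof.
apply/seteqP; split=> -[a b]; rewrite /pdisc /disc /plane /= => h.
  by move: h; rewrite -[X in _ < X]sqrtr1 ltr_sqrt.
by rewrite -[X in _ < X]sqrtr1 ltr_sqrt.
Qed.

Lemma measurable_pdisc : measurable pdisc.
Proof.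
rewrite pdiscE -[X in measurable X]setTI.
rewrite (_ : [set x | _] =
  (fun x : R2 => (x.1 : R) ^+ 2 + (x.2 : R) ^+ 2) @^-1` `]-oo, 1[%classic).
  have mf : measurable_fun [set: R2]
      (fun x : R2 => (x.1 : R) ^+ 2 + (x.2 : R) ^+ 2).
    apply: measurable_funD; apply: measurable_funX.
      exact: measurable_fst.
    exact: measurable_snd.
  exact: mf.
by apply/seteqP; split=> x /=; rewrite in_itv.
Qed.

Let square (a : R) : set R2 :=
  (`[- a, a]%classic : set (measurableTypeR R)) `*` `[- a, a]%classic.

Let area_square (a : R) : 0 < a -> area (square a) = ((a *+ 2) ^+ 2)%:E.
Proof.
move=> a0; rewrite [LHS]product_measure1E//=.
rewrite !lebesgue_measure_itv/= lte_fin gtrN// -EFinD -EFinM opprK.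
by rewrite -mulr2n expr2.
Qed.

Let measurable_square (a : R) : measurable (square a).
Proof. exact: measurableX. Qed.

Lemma sigma_pdisc : sigma pdisc = 1%E.
Proof.
have ub : (area pdisc <= ((1 *+ 2) ^+ 2)%:E)%E.
  rewrite -area_square//; apply: le_measure; rewrite ?inE//.
    exact: measurable_pdisc.
  have sqle (u v : R) : u ^+ 2 + v ^+ 2 < 1 -> -1 <= u <= 1.
    move=> uv; rewrite -ler_norml -(@expr_le1 _ 2)// real_normK ?num_real//.
    by rewrite (le_trans _ (ltW uv))// lerDl sqr_ge0.
  rewrite pdiscE => -[x y] /= h; split; rewrite /= in_itv /=.
    exact: sqle h.
  by apply: (sqle _ x); rewrite addrC.
have lb : (((2^-1 *+ 2) ^+ 2)%:E <= area pdisc)%E.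
  rewrite -area_square ?invr_gt0//; apply: le_measure; rewrite ?inE//.
    exact: measurable_pdisc.
  have sqle (u : R) : - 2^-1 <= u <= 2^-1 -> u ^+ 2 <= 2^-1 ^+ 2.
    move=> h; rewrite -real_normK ?num_real//.
    by rewrite lerXn2r ?nnegrE ?invr_ge0// ler_norml.
  rewrite pdiscE => -[x y] [] /=; rewrite !in_itv /= => /sqle hx /sqle hy.
  apply: (le_lt_trans (lerD hx hy)).
  rewrite -mulr2n expr2 -mulrnAl -mulr_natr mulVf ?pnatr_eq0// mul1r.
  by rewrite invf_lt1// ltr1n.
have fin : area pdisc \is a fin_num.
  by rewrite ge0_fin_numE//; apply: (le_lt_trans ub); exact: ltry.
rewrite -(fineK fin) lee_fin in lb.
have pos : fine (area pdisc) != 0.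
  rewrite gt_eqF//; apply: lt_le_trans lb.
  by rewrite exprn_gt0// pmulrn_lgt0// invr_gt0.
by rewrite /sigma /= /mscale /= -{2}(fineK fin) -EFinM mulVf.
Qed.

Local Notation C := (R[i]^o).

Definition analytic (f : R[i] -> R[i]) : Prop :=
  forall z0, disc z0 -> exists (r : R) (a : nat -> R[i]), 0 < r /\
    forall z, normc (z - z0) < r ->
      series (fun n => a n * (z - z0) ^+ n : C) @ \oo --> (f z : C).

Definition bergman_norm (p : R) (f : R[i] -> R[i]) : \bar R :=
  ((\int[sigma]_(x in pdisc) (normc (f (plane x)) `^ p)%:E) `^ p^-1)%E.

Definition bergman (p : R) : set (R[i] -> R[i]) :=
  [set f | analytic f /\ (bergman_norm p f < +oo)%E].

Definition cintegral (g : R[i] -> R[i]) : R[i] :=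
  (\int[sigma]_(x in pdisc) complex.Re (g (plane x)))%R +i*
  (\int[sigma]_(x in pdisc) complex.Im (g (plane x)))%R.

(* Functions are total on R[i]. Boundedness for the seminorm [bergman_norm]
   forces [phi f] to depend only on the values of [f] in the disc, so these are
   exactly the elements of the dual of A^p. Nothing is required of [phi] outside
   [bergman p]. *)
Definition bergman_dual (p : R) : set ((R[i] -> R[i]) -> R[i]) :=
  [set phi |
    (forall (a : R[i]) f g, bergman p f -> bergman p g ->
       phi (fun z => a * f z + g z) = a * phi f + phi g) /\
    (exists M : R, forall f, bergman p f ->
       ((normc (phi f))%:E <= M%:E * bergman_norm p f)%E)].

Definition lin_indep (p : R) (N : nat)
    (phi : 'I_N -> (R[i] -> R[i]) -> R[i]) : Prop :=
  forall c : 'I_N -> R[i],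
    (forall f, bergman p f -> \sum_(i < N) c i * phi i f = 0) ->
    forall i, c i = 0.

Definition is_kernel (p q : R) (phi : (R[i] -> R[i]) -> R[i])
    (k : R[i] -> R[i]) : Prop :=
  bergman q k /\
  forall f, bergman p f -> phi f = cintegral (fun z => f z * (k z)^*).

Definition bergman_proj (f : R[i] -> R[i]) (z : R[i]) : R[i] :=
  cintegral (fun w => f w / (1 - w^* * z) ^+ 2).

Definition csgn (w : R[i]) : R[i] := if w == 0 then 0 else w / (normc w)%:C.

End Disc.

(* Main.v *)
Require Import Defs.
From mathcomp Require Import all_boot all_order all_algebra.
From mathcomp Require Import all_classical all_reals all_analysis.
From mathcomp Require Import measurable_realfun.
From mathcomp Require Import complex.
From mathcomp Require Import ring lra.
Set Implicit Arguments.
Unset Strict Implicit.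
Unset Printing Implicit Defensive.
Import Order.TTheory GRing.Theory Num.Theory.
Import numFieldNormedType.Exports.
Import Normc.

Local Open Scope classical_set_scope.
Local Open Scope ring_scope.
Local Open Scope complex_scope.
(* In [ring_scope] this notation stands for [Num.conj]; both conjugations are
   convertible on R[i], but rewriting needs a single one. *)
Local Notation "z ^*" := (conjc z) : ring_scope.

(** Write G for |F|^(p-1) sgn F, which lies in L^q, and <h, g> for the integral
    of h times the conjugate of g over the disc.

    The extremal problem is settled by the first variation. Young's inequality
    a b <= a^p/p + b^q/q, applied to |f| and |F|^(p-1), gives
    Re <f, G> <= (1/p) |f|_p^p + (1/q) |F|_p^p, with equality at f = F
    ([Re_dint_young]). So if <f, G> = <F, G> for all competitors f then F is
    extremal ([pmass_le]). Conversely, the same inequality at F + t h and t -> 0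
    show that an extremal F has <h, G> = 0 for every h in A^p that all the phi_i
    kill ([first_variation_ge0], [extremal_orthogonal]). By linear algebra
    ([span_of_common_kernel]) this says that h |-> <h, G> is a combination of
    the phi_i on A^p, that is, that <h, G - K> = 0 on A^p for some combination
    K of the kernels k_i.

    It remains to see that G - K annihilates A^p if and only if its Bergman
    projection vanishes on the disc. Up to conjugation, the projection of g at
    z is the pairing of g with the Bergman kernel b_z, and b_z lies in A^p;
    together with the reproducing formula ([bergman_reproducing]), which says
    that the k_i are their own projections, this gives one direction. For the
    other, expanding b_z in powers of the conjugate of z shows that a function
    orthogonal to all the b_z is orthogonal to all monomials
    ([dint_monom_eq0]), and monomials suffice because the dilates f(r w),
    r -> 1, of f in A^p converge weakly to f ([dint_dilation_cvg]) and are
    uniform limits of polynomials ([dint_bergman_eq0]).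

    Two classical facts underlie this. First, the orthogonality of the
    monomials on the disc ([dint_monom]): the area is invariant under rotations,
    a rotation being a product of three shears, and the square norms 1/(n+1)
    follow from the scaling of the area alone. Second, a function with local
    power series expansions is the sum of one power series on the whole disc
    ([analytic_pseries]). No contour integral is used: if the series at 0
    represents f on |z| < rho, then by compactness the local expansions at the
    points of this disc have a common radius s and a common bound. Their
    coefficients are the values of the power series
    sum_n C(n,j) a_n z^(n-j), and the orthogonality of the monomials bounds its
    coefficients C(n,j) a_n in turn. Summing over j against (s/2)^j shows that
    the radius of convergence of sum_n a_n z^n exceeds rho. *)

(** * Limits of complex sequences *)

Section ComplexLimits.
Variable R : realType.
Implicit Types (z w : R[i]) (u v : nat -> R[i]) (a c : nat -> R[i]).

Lemma normc_ge0 z : 0 <= normc z.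
Proof. by case: z => x y; rewrite sqrtr_ge0. Qed.

Lemma normE z : `|z| = (normc z)%:C. Proof. by []. Qed.

Lemma normcX z n : normc (z ^+ n) = normc z ^+ n.
Proof. by elim: n => [|n IH]; rewrite ?normc1// !exprS normcM IH. Qed.

Lemma normc_real (x : R) : normc x%:C = `|x|.
Proof. by rewrite /normc /= expr0n /= addr0 sqrtr_sqr. Qed.

Lemma normc_conj z : normc z^* = normc z.
Proof. by case: z => x y; rewrite /= sqrrN. Qed.

Lemma normc_distC z w : normc (z - w) = normc (w - z).
Proof. by rewrite -normcN opprB. Qed.

Lemma ler_normcB z w : normc (z - w) <= normc z + normc w.
Proof. by rewrite (le_trans (le_normcD _ _))// normcN. Qed.

Lemma Re_le_normc z : `|complex.Re z| <= normc z.
Proof. by case: z => x y /=; rewrite -sqrtr_sqr ler_wsqrtr// lerDl sqr_ge0. Qed.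

Lemma Im_le_normc z : `|complex.Im z| <= normc z.
Proof. by case: z => x y /=; rewrite -sqrtr_sqr ler_wsqrtr// lerDr sqr_ge0. Qed.

Lemma normc_le_ReIm z : normc z <= `|complex.Re z| + `|complex.Im z|.
Proof.
case: z => x y /=; have h : 0 <= `|x| + `|y| by rewrite addr_ge0.
rewrite -[leRHS](ger0_norm h) -sqrtr_sqr ler_wsqrtr//.
rewrite sqrrD !real_normK ?num_real// addrAC lerDl mulrn_wge0// mulr_ge0//.
Qed.

Lemma normc_gt0 z : (0 < normc z) = (z != 0).
Proof.
rewrite lt_def normc_ge0 andbT; congr negb.
by apply/eqP/eqP => [/eq0_normc//|->]; rewrite normc0.
Qed.

Lemma ler_normc_sum (I : Type) (r : seq I) (P : pred I) (f : I -> R[i]) :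
  normc (\sum_(i <- r | P i) f i) <= \sum_(i <- r | P i) normc (f i).
Proof.
elim/big_rec2: _ => [|i x y _ h]; first by rewrite normc0.
by rewrite (le_trans (le_normcD _ _))// lerD2l.
Qed.

Lemma cReD z w : complex.Re (z + w) = complex.Re z + complex.Re w.
Proof. by case: z; case: w. Qed.
Lemma cImD z w : complex.Im (z + w) = complex.Im z + complex.Im w.
Proof. by case: z; case: w. Qed.
Lemma cReB z w : complex.Re (z - w) = complex.Re z - complex.Re w.
Proof. by case: z; case: w. Qed.
Lemma cImB z w : complex.Im (z - w) = complex.Im z - complex.Im w.
Proof. by case: z; case: w. Qed.
Lemma cReM z w : complex.Re (z * w) =
  complex.Re z * complex.Re w - complex.Im z * complex.Im w.
Proof. by case: z; case: w. Qed.
Lemma cImM z w : complex.Im (z * w) =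
  complex.Re z * complex.Im w + complex.Im z * complex.Re w.
Proof. by case: z; case: w. Qed.
Lemma Re_conj z : complex.Re z^* = complex.Re z. Proof. by case: z. Qed.
Lemma Im_conj z : complex.Im z^* = - complex.Im z. Proof. by case: z. Qed.
Lemma Re_sum (I : Type) (r : seq I) (P : pred I) (f : I -> R[i]) :
  complex.Re (\sum_(i <- r | P i) f i) = \sum_(i <- r | P i) complex.Re (f i).
Proof. by elim/big_rec2: _ => // i x y _ <-; rewrite cReD. Qed.
Lemma Im_sum (I : Type) (r : seq I) (P : pred I) (f : I -> R[i]) :
  complex.Im (\sum_(i <- r | P i) f i) = \sum_(i <- r | P i) complex.Im (f i).
Proof. by elim/big_rec2: _ => // i x y _ <-; rewrite cImD. Qed.

Lemma eqcP z w : complex.Re z = complex.Re w -> complex.Im z = complex.Im w ->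
  z = w.
Proof. by case: z => ? ?; case: w => ? ? /= -> ->. Qed.

Lemma conjcM z w : (z * w)^* = z^* * w^*.
Proof. by apply: eqcP; rewrite ?Re_conj ?Im_conj ?cReM ?cImM ?Re_conj ?Im_conj; ring. Qed.
Lemma conjcX z n : (z ^+ n)^* = z^* ^+ n.
Proof. exact: rmorphXn. Qed.

(** Convergence for the norm [normc], which takes its values in R, so that
    real estimates apply; [ccvgP] compares it with the topology of R[i]. *)
Definition ccvg u z := normc (u n - z) @[n --> \oo] --> (0 : R).

Lemma ccvgP u z : ((u : nat -> R[i]^o) @ \oo --> (z : R[i]^o)) <-> ccvg u z.
Proof.
rewrite /ccvg; split => h.
- apply/cvgrPdist_lt => e e0.
  have e0' : 0 < e%:C by rewrite ltcR.
  move/cvgrPdist_lt : h => /(_ _ e0'); apply: filterS => n.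
  by rewrite normE ltcR sub0r normrN (ger0_norm (normc_ge0 _)) normc_distC.
- apply/cvgrPdist_lt => e; rewrite ltcE /= => /andP[/eqP ei er].
  move/cvgrPdist_lt : h => /(_ _ er); apply: filterS => n.
  rewrite sub0r normrN (ger0_norm (normc_ge0 _)) normc_distC.
  by rewrite normE ltcE /= ei eqxx.
Qed.

Lemma eq_ccvg u v z : u =1 v -> ccvg u z -> ccvg v z.
Proof. by move=> /funext ->. Qed.

Lemma ccvg_squeeze u z (b : nat -> R) : (forall n, normc (u n - z) <= b n) ->
  b n @[n --> \oo] --> (0 : R) -> ccvg u z.
Proof.
move=> ub b0; apply: (@squeeze_cvgr _ _ _ _ (cst 0) b) => //; last exact: cvg_cst.
by near=> n; rewrite /cst ub normc_ge0.
Unshelve. all: by end_near. Qed.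

Lemma ccvg_cst z : ccvg (fun=> z) z.
Proof. by rewrite /ccvg; under eq_fun do rewrite subrr normc0; exact: cvg_cst. Qed.

Lemma ccvgD u v z w : ccvg u z -> ccvg v w -> ccvg (fun n => u n + v n) (z + w).
Proof.
move=> uz vw; apply: (@ccvg_squeeze _ _ (fun n => normc (u n - z) + normc (v n - w))).
  by move=> n; rewrite opprD addrACA le_normcD.
by rewrite -(addr0 0); exact: cvgD.
Qed.

Lemma ccvgZ u z w : ccvg u z -> ccvg (fun n => w * u n) (w * z).
Proof.
move=> uz; rewrite /ccvg; under eq_fun do rewrite -mulrBr normcM.
by rewrite -(mulr0 (normc w)); apply: cvgM => //; exact: cvg_cst.
Qed.

Lemma ccvgN u z : ccvg u z -> ccvg (fun n => - u n) (- z).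
Proof.
by move=> /(ccvgZ (-1)); rewrite mulN1r; under eq_fun do rewrite mulN1r.
Qed.

Lemma ccvgB u v z w : ccvg u z -> ccvg v w -> ccvg (fun n => u n - v n) (z - w).
Proof. by move=> uz /ccvgN; exact: ccvgD. Qed.

Lemma ccvg_conj u z : ccvg u z -> ccvg (fun n => (u n)^*) z^*.
Proof.
by rewrite /ccvg => h; under eq_fun do rewrite -rmorphB normc_conj.
Qed.

Lemma ccvg_normc u z : ccvg u z -> normc (u n) @[n --> \oo] --> normc z.
Proof.
move=> uz; apply/subr_cvg0.
apply: (@squeeze_cvgr _ _ _ _ (fun n => - normc (u n - z)) (fun n => normc (u n - z))) => //.
  near=> n; apply/andP; split; last first.
    by rewrite lerBlDr -{1}(subrK z (u n)) le_normcD.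
  rewrite lerBrDr addrC lerBlDr addrC normc_distC.
  by rewrite -{1}(subrK (u n) z) le_normcD.
by rewrite -oppr0; exact: cvgN.
Unshelve. all: by end_near. Qed.

Lemma ccvg_unique u z w : ccvg u z -> ccvg u w -> z = w.
Proof.
move=> uz uw; have := ccvgB uz uw; rewrite /ccvg.
under eq_fun do rewrite subrr sub0r normcN.
move=> h; apply/eqP; rewrite -subr_eq0; apply/eqP/eq0_normc.
by apply: (@cvg_unique _ _ _ _ _ _ _ h); first exact: Rhausdorff; exact: cvg_cst.
Qed.

Lemma ccvg_ReIm u z : complex.Re (u n) @[n --> \oo] --> complex.Re z ->
  complex.Im (u n) @[n --> \oo] --> complex.Im z -> ccvg u z.
Proof.
move=> /subr_cvg0 hr /subr_cvg0 hi.
apply: (@ccvg_squeeze _ _ (fun n => `|complex.Re (u n) - complex.Re z| + `|complex.Im (u n) - complex.Im z|)).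
  by move=> n; rewrite -cReB -cImB normc_le_ReIm.
by rewrite -(addr0 0); apply: cvgD; rewrite -(normr0 R); apply: cvg_norm.
Qed.

Lemma ccvg_Re u z : ccvg u z -> complex.Re (u n) @[n --> \oo] --> complex.Re z.
Proof.
move=> uz; apply/subr_cvg0/norm_cvg0P.
apply: (@squeeze_cvgr _ _ _ _ (cst 0) (fun n => normc (u n - z))) => //; last exact: cvg_cst.
by near=> n; rewrite normr_ge0 -cReB Re_le_normc.
Unshelve. all: by end_near. Qed.

Lemma ccvg_Im u z : ccvg u z -> complex.Im (u n) @[n --> \oo] --> complex.Im z.
Proof.
move=> uz; apply/subr_cvg0/norm_cvg0P.
apply: (@squeeze_cvgr _ _ _ _ (cst 0) (fun n => normc (u n - z))) => //; last exact: cvg_cst.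
by near=> n; rewrite normr_ge0 -cImB Im_le_normc.
Unshelve. all: by end_near. Qed.

Lemma ccvg_shift u z k : ccvg u z -> ccvg (fun n => u (n + k)%N) z.
Proof.
by rewrite /ccvg => h; exact: (cvg_comp _ _ (cvg_addnr k) h).
Qed.

Lemma ccvg_le u z w (b : R) N :
  ccvg u z -> (forall n, (N <= n)%N -> normc (u n - w) <= b) -> normc (z - w) <= b.
Proof.
move=> uz ub; have h := ccvg_normc (ccvgB uz (ccvg_cst w)).
apply: (cvgr_to_le h); exists N => // n /= Nn; exact: ub.
Qed.

End ComplexLimits.

(** * Power series with complex coefficients *)

Section PowerSeries.
Variable R : realType.
Implicit Types (z w l : R[i]) (u v : nat -> R[i]) (a b c : nat -> R[i]).
Implicit Types (M s t : R).

Lemma sum_geo_le M t m n : 0 <= M -> 0 <= t -> t < 1 ->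
  \sum_(m <= k < n) M * t ^+ k <= M * t ^+ m / (1 - t).
Proof.
move=> M0 t0 t1; have t1' : 0 < 1 - t by rewrite subr_gt0.
case: (leqP m n) => [mn|/ltnW nm]; last first.
  by rewrite big_geq// divr_ge0 ?mulr_ge0 ?exprn_ge0 ?(ltW t1')//.
rewrite ler_pdivlMr// -mulr_sumr -mulrA ler_wpM2l// mulrBr mulr1 mulr_suml.
under [X in _ - X]eq_bigr do rewrite -exprSr.
rewrite -sumrB -(opprK (\sum_(_ <= _ < _) _)) -sumrN.
under eq_bigr do rewrite opprB.
by rewrite telescope_sumr// opprB lerBlDr lerDl exprn_ge0.
Qed.

Lemma natr_geo_le t n : 0 <= t -> t < 1 -> n%:R * t ^+ n <= (1 - t)^-1.
Proof.
move=> t0 t1; apply: le_trans (_ : \sum_(0 <= k < n) 1 * t ^+ k <= _); last first.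
  by rewrite (le_trans (sum_geo_le _ _ _ _ _))// expr0 mul1r div1r.
rewrite mulr_natl -[n in _ *+ n]subn0 -sumr_const_nat; apply: ler_sum_nat => k /= kn.
by rewrite mul1r ler_wiXn2l// ?(ltW t1)// ltnW.
Qed.

Lemma cvg_natr_geo M t : 0 <= t -> t < 1 ->
  n%:R * (M * t ^+ n) @[n --> \oo] --> (0 : R).
Proof.
move=> t0 t1; pose r := Num.sqrt t.
have r0 : 0 <= r by exact: sqrtr_ge0.
have r1 : r < 1 by rewrite -sqrtr1 ltr_sqrt.
(* n r^n is bounded, so n t^n = (n r^n) r^n tends to 0. *)
have rr : t = r * r by rewrite -expr2 sqr_sqrtr.
apply/norm_cvg0P.
apply: (@squeeze_cvgr _ _ _ _ (cst 0) (fun n => (`|M| / (1 - r)) * r ^+ n)).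
- near=> n; rewrite normr_ge0 /=.
  rewrite !normrM normr_nat (ger0_norm (exprn_ge0 _ t0)) {1}rr exprMn.
  rewrite mulrCA -mulrA ler_wpM2l// mulrA ler_wpM2r ?exprn_ge0//.
  exact: natr_geo_le.
- exact: cvg_cst.
- by apply: cvg_geometric; rewrite ger0_norm.
Unshelve. all: by end_near. Qed.

Lemma Re_series u n : complex.Re (series u n) = series (fun k => complex.Re (u k)) n.
Proof. by rewrite /series /= Re_sum. Qed.
Lemma Im_series u n : complex.Im (series u n) = series (fun k => complex.Im (u k)) n.
Proof. by rewrite /series /= Im_sum. Qed.

(** The junk value 0 in case of divergence never matters: [csum] is only used
    under a geometric bound on the terms. *)
Definition csum u : R[i] := xget 0 [set l | ccvg (series u) l].

Lemma csumE u l : ccvg (series u) l -> csum u = l.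
Proof. move=> h; apply: xget_unique => // y hy; exact: (ccvg_unique hy h). Qed.

Lemma ccvg_series_geo u M t : 0 <= t -> t < 1 ->
  (forall n, normc (u n) <= M * t ^+ n) -> ccvg (series u) (csum u).
Proof.
move=> t0 t1 ub.
suff [l h] : exists l, ccvg (series u) l by rewrite (csumE h).
have key (f : R[i] -> R) : (forall z, `|f z| <= normc z) ->
    cvgn (series (fun k => f (u k))).
  move=> fle; apply: normed_cvg.
  apply: (@series_le_cvg _ _ (fun k => M * t ^+ k)) => [n|n|n|].
  - exact: normr_ge0.
  - exact: le_trans (normc_ge0 _) (ub n).
  - exact: le_trans (fle _) (ub n).
  - by apply: is_cvg_geometric_series; rewrite ger0_norm.
have hr := key _ (@Re_le_normc R); have hi := key _ (@Im_le_normc R).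
exists (limn (series (fun k => complex.Re (u k))) +i*
        limn (series (fun k => complex.Im (u k)))).
apply: ccvg_ReIm => /=.
- by under eq_fun do rewrite Re_series.
- by under eq_fun do rewrite Im_series.
Qed.

Lemma series_geo_tail u M t l n : 0 <= t -> t < 1 ->
  (forall n, normc (u n) <= M * t ^+ n) -> ccvg (series u) l ->
  normc (l - series u n) <= M * t ^+ n / (1 - t).
Proof.
move=> t0 t1 ub ul; have M0 : 0 <= M.
  by have := ub 0%N; rewrite expr0 mulr1; apply: le_trans; exact: normc_ge0.
apply: (@ccvg_le _ _ _ _ _ n ul) => m nm.
rewrite sub_series_geq//; apply: le_trans (ler_normc_sum _ _ _) _.
by apply: le_trans (sum_geo_le _ _ M0 t0 t1); apply: ler_sum => k _; exact: ub.
Qed.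

Lemma pseries_bounded a z l : ccvg (series (fun n => a n * z ^+ n)) l ->
  exists M, forall n, normc (a n) * normc z ^+ n <= M.
Proof.
move=> h; have h1 : normc (series (fun n => a n * z ^+ n) n.+1 -
    series (fun n => a n * z ^+ n) n) @[n --> \oo] --> (0 : R).
  have := ccvg_normc (ccvgB (@ccvg_shift _ _ _ 1 h) h).
  by rewrite subrr normc0; under eq_fun do rewrite addn1.
have [M [_ hM]] := cvg_seq_bounded (cvgP _ h1).
exists (M + 1) => n; have := hM (M + 1); rewrite ltrDl ltr01 => /(_ erefl n Logic.I).
rewrite /series /= big_nat_recr//= addrAC subrr add0r normcM normcX.
by rewrite ger0_norm// mulr_ge0 ?exprn_ge0 ?normc_ge0.
Qed.

(** The form in which convergence is used: it holds for some M as soon as the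
    series converges at one point of modulus s, and it makes the series converge
    absolutely on |z| < s. *)
Definition geo_bounded a s M := forall n, normc (a n) * s ^+ n <= M.

Lemma geo_bounded_le a s M t n : geo_bounded a s M -> 0 < s -> 0 <= t ->
  normc (a n) * t ^+ n <= M * (t / s) ^+ n.
Proof.
move=> h s0 t0; rewrite expr_div_n mulrA ler_pdivlMr ?exprn_gt0//.
by rewrite mulrAC ler_wpM2r// exprn_ge0.
Qed.

Lemma ccvg_pseries a s M z : geo_bounded a s M -> normc z < s ->
  ccvg (series (fun n => a n * z ^+ n)) (csum (fun n => a n * z ^+ n)).
Proof.
move=> h zs; have s0 : 0 < s by apply: le_lt_trans zs; exact: normc_ge0.
apply: (@ccvg_series_geo _ M (normc z / s)).
- by rewrite divr_ge0 ?normc_ge0// ltW.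
- by rewrite ltr_pdivrMr// mul1r.
- by move=> n; rewrite normcM normcX; apply: geo_bounded_le => //; exact: normc_ge0.
Qed.

Lemma bin_term_le (x y : R) m j : 0 <= x -> 0 <= y ->
  'C(m, j)%:R * x ^+ (m - j) * y ^+ j <= (x + y) ^+ m.
Proof.
move=> x0 y0; case: (leqP j m) => jm; last first.
  by rewrite bin_small// !mul0r exprn_ge0// addr_ge0.
rewrite exprDn (bigD1 (inord j : 'I_m.+1))//= inordK ?ltnS//.
rewrite -mulrA mulr_natl lerDl sumr_ge0// => i _.
by rewrite mulrn_wge0// mulr_ge0// exprn_ge0.
Qed.

Definition reexp_term a z j m : R[i] := 'C(m, j)%:R * a m * z ^+ (m - j).
(** The coefficient of v^j in the formal expansion of sum_m a_m (z + v)^m. *)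
Definition reexp a z j : R[i] := csum (reexp_term a z j).

Lemma normc_nat n : normc (n%:R : R[i]) = n%:R.
Proof. by rewrite -[n%:R](rmorph_nat (real_complex R)) normc_real ger0_norm. Qed.

(** C(m,j) |z|^(m-j) y^j is one of the terms of the binomial expansion of
    (|z| + y)^m. *)
Lemma reexp_term_le a s M z y j m : geo_bounded a s M -> 0 < s -> 0 <= y ->
  normc (reexp_term a z j m) * y ^+ j <= M * ((normc z + y) / s) ^+ m.
Proof.
move=> h s0 y0; apply: le_trans (geo_bounded_le m h s0 (addr_ge0 (normc_ge0 z) y0)).
rewrite /reexp_term !normcM normcX normc_nat.
rewrite [_%:R * _]mulrC -!mulrA ler_wpM2l ?normc_ge0// mulrA.
by apply: bin_term_le => //; exact: normc_ge0.
Qed.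

Lemma reexp_cvg a s M z j : geo_bounded a s M -> normc z < s ->
  ccvg (series (reexp_term a z j)) (reexp a z j).
Proof.
move=> h zs; have s0 : 0 < s by apply: le_lt_trans zs; exact: normc_ge0.
pose y := (s - normc z) / 2.
have y0 : 0 < y by rewrite divr_gt0// subr_gt0.
have zy0 : 0 <= normc z + y by rewrite addr_ge0 ?normc_ge0// ltW.
apply: (@ccvg_series_geo _ (M / y ^+ j) ((normc z + y) / s)).
- by rewrite divr_ge0// ltW.
- by rewrite ltr_pdivrMr// mul1r /y; lra.
- move=> n; rewrite mulrAC ler_pdivlMr ?exprn_gt0//.
  by apply: reexp_term_le => //; exact: ltW.
Qed.

Lemma reexp_tail a s M z y j n : geo_bounded a s M -> 0 <= y -> normc z + y < s ->
  normc (reexp a z j - series (reexp_term a z j) n) * y ^+ j <=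
  M * ((normc z + y) / s) ^+ n / (1 - (normc z + y) / s).
Proof.
move=> h y0 zys; have zs : normc z < s by apply: le_lt_trans zys; rewrite lerDl.
have s0 : 0 < s by apply: le_lt_trans zs; exact: normc_ge0.
have yE : y ^+ j = normc ((y%:C) ^+ j) by rewrite normcX normc_real ger0_norm.
rewrite yE -normcM mulrC mulrBr.
have -> : (y%:C) ^+ j * series (reexp_term a z j) n =
    series (fun m => (y%:C) ^+ j * reexp_term a z j m) n.
  by rewrite /series /= mulr_sumr.
apply: series_geo_tail.
- by rewrite divr_ge0 ?addr_ge0 ?normc_ge0// ltW.
- by rewrite ltr_pdivrMr// mul1r.
- by move=> m; rewrite mulrC normcM -yE; exact: reexp_term_le.
- have := ccvgZ (y%:C ^+ j) (reexp_cvg j h zs).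
  by apply: eq_ccvg => m; rewrite /series /= mulr_sumr.
Qed.

Lemma reexp_bounded a s M z y : geo_bounded a s M -> 0 <= y -> normc z + y < s ->
  geo_bounded (reexp a z) y (M / (1 - (normc z + y) / s)).
Proof.
move=> h y0 zys j; have := reexp_tail j 0 h y0 zys.
by rewrite /series /= big_geq// subr0 expr0 mulr1.
Qed.

(** The truncations at order n of both series differ by n tails of the series
    defining the coefficients, each of size O(t^n) with t < 1, and n t^n tends
    to 0; no double series is needed. *)
Lemma reexp_sum a s M z (v : R[i]) l : geo_bounded a s M -> normc z + normc v < s ->
  ccvg (series (fun m => a m * (z + v) ^+ m)) l ->
  ccvg (series (fun j => reexp a z j * v ^+ j)) l.
Proof.
move=> h zvs al; have v0 := normc_ge0 v.
have zs : normc z < s by apply: le_lt_trans zvs; rewrite lerDl.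
have s0 : 0 < s by apply: le_lt_trans zs; exact: normc_ge0.
set t := (normc z + normc v) / s.
have t0 : 0 <= t by rewrite divr_ge0 ?addr_ge0 ?normc_ge0// ltW.
have t1 : t < 1 by rewrite ltr_pdivrMr// mul1r.
have finE n : series (fun m => a m * (z + v) ^+ m) n =
    \sum_(0 <= j < n) series (reexp_term a z j) n * v ^+ j.
  rewrite /series /=; under [RHS]eq_bigr do rewrite mulr_suml.
  rewrite exchange_big /= big_nat [RHS]big_nat; apply: eq_bigr => m /andP[_ mn].
  rewrite exprDn mulr_sumr -(big_mkord predT (fun i => a m * (z ^+ (m - i) * v ^+ i *+ 'C(m, i)))).
  rewrite [RHS](big_cat_nat _ (n := m.+1))//= [X in _ + X]big_nat [X in _ + X]big1 ?addr0; last first.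
    by move=> j /andP[mj _]; rewrite /reexp_term bin_small// !mul0r.
  apply: eq_bigr => j _; rewrite /reexp_term -mulr_natl; ring.
have : ccvg (fun n => (series (fun j => reexp a z j * v ^+ j) n -
    series (fun m => a m * (z + v) ^+ m) n) + series (fun m => a m * (z + v) ^+ m) n) (0 + l).
  apply: ccvgD => //.
  apply: (@ccvg_squeeze _ _ _ (fun n => n%:R * ((M / (1 - t)) * t ^+ n))); last exact: cvg_natr_geo.
  move=> n; rewrite subr0 finE /series /= -sumrB.
  apply: le_trans (ler_normc_sum _ _ _) _.
  rewrite mulr_natl -[n in _ *+ n]subn0 -sumr_const_nat; apply: ler_sum => j _.
  rewrite -mulrBl normcM normcX [leRHS]mulrAC.
  exact: (reexp_tail j n h).
by rewrite add0r; under eq_fun do rewrite subrK.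
Qed.

(** At |v| = s t the first nonzero term d_n v^n of the difference must be
    cancelled by the later ones, which are O(t^(n+1)), while it has size t^n. *)
Lemma pseries_unique a b (r : R) (f : R[i] -> R[i]) : 0 < r ->
  (forall v : R[i], normc v < r -> ccvg (series (fun n => a n * v ^+ n)) (f v)) ->
  (forall v : R[i], normc v < r -> ccvg (series (fun n => b n * v ^+ n)) (f v)) ->
  a = b.
Proof.
move=> r0 ha hb; pose d n := a n - b n.
have hd (v : R[i]) : normc v < r -> ccvg (series (fun n => d n * v ^+ n)) 0.
  move=> vr; have := ccvgB (ha v vr) (hb v vr); rewrite subrr.
  by apply: eq_ccvg => n; rewrite /series /= -sumrB; apply: eq_bigr => i _; rewrite mulrBl.
suff d0 n : d n = 0 by apply/funext => n; apply/eqP; rewrite -subr_eq0; apply/eqP/d0.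
pose s := r / 2; have s0 : 0 < s by rewrite divr_gt0.
have ns : normc (s%:C) = s by rewrite normc_real ger0_norm// ltW.
have [|M hM] := @pseries_bounded d s%:C 0.
  by apply: hd; rewrite ns /s; lra.
rewrite ns in hM.
have M0 : 0 <= M by apply: le_trans (hM 0%N); rewrite mulr_ge0 ?normc_ge0 ?exprn_ge0// ltW.
elim/ltn_ind: n => n IH; apply/eqP; rewrite -[_ == 0]negbK -normc_gt0 -leNgt.
suff key t : 0 < t -> t < 1 / 2 -> normc (d n) * s ^+ n <= 2 * M * t.
  rewrite leNgt; apply/negP => dn0.
  pose x := normc (d n) * s ^+ n.
  have x0 : 0 < x by rewrite mulr_gt0// exprn_gt0.
  have tx0 : 0 < x / (4 * M + 4 * x) by rewrite divr_gt0//; lra.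
  have tlt : x / (4 * M + 4 * x) < 1 / 2 by rewrite ltr_pdivrMr; lra.
  have := key _ tx0 tlt; rewrite -/x.
  rewrite [2 * M * _]mulrA ler_pdivlMr; last lra.
  by nra.
move=> t0 t1; have ts : normc (s * t)%:C = s * t.
  by rewrite normc_real ger0_norm// mulr_ge0// ltW.
have tlt1 : t < 1 by lra.
have hgeo m : normc (d m * (s * t)%:C ^+ m) <= M * t ^+ m.
  by rewrite normcM normcX ts exprMn mulrA ler_wpM2r// exprn_ge0// ltW.
have h0 : ccvg (series (fun m => d m * (s * t)%:C ^+ m)) 0.
  by apply: hd; rewrite ts /s; nra.
have := series_geo_tail n.+1 (ltW t0) tlt1 hgeo h0.
rewrite sub0r normcN /series /= big_nat_recr//= big_nat big1 ?add0r; last first.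
  by move=> i /andP[_ ni]; rewrite IH// mul0r.
rewrite !normcM normcX ts exprMn mulrA.
rewrite ler_pdivlMr; last lra.
rewrite exprSr => hh; have tn : 0 < t ^+ n by rewrite exprn_gt0.
have x0 : 0 <= normc (d n) * s ^+ n by rewrite mulr_ge0 ?normc_ge0 ?exprn_ge0// ltW.
have : normc (d n) * s ^+ n * (1 - t) <= M * t.
  rewrite -(ler_pM2r tn); move: hh; lra.
nra.
Qed.

End PowerSeries.

(** * Integration of complex-valued functions *)

Section ComplexIntegral.
Context d (T : measurableType d) (R : realType) (mu : {measure set T -> \bar R}).
Variables (D : set T) (mD : measurable D).
Implicit Types (f g h : T -> R[i]) (w : T -> R).

Definition cmeas f := measurable_fun D (fun x => complex.Re (f x)) /\
  measurable_fun D (fun x => complex.Im (f x)).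

Definition cintegrable f :=
  mu.-integrable D (EFin \o (fun x => complex.Re (f x))) /\
  mu.-integrable D (EFin \o (fun x => complex.Im (f x))).

Definition cint f : R[i] := (\int[mu]_(x in D) complex.Re (f x))%R +i*
  (\int[mu]_(x in D) complex.Im (f x))%R.

Lemma cmeas_cst z : cmeas (cst z).
Proof. by split; exact: measurable_cst. Qed.

Lemma cmeasD f g : cmeas f -> cmeas g -> cmeas (fun x => f x + g x).
Proof.
move=> [fr fi] [gr gi]; split.
- by under eq_fun do rewrite cReD; exact: measurable_funD.
- by under eq_fun do rewrite cImD; exact: measurable_funD.
Qed.

Lemma cmeasM f g : cmeas f -> cmeas g -> cmeas (fun x => f x * g x).
Proof.
move=> [fr fi] [gr gi]; split.
- under eq_fun do rewrite cReM.
  by apply: measurable_funB; exact: measurable_funM.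
- under eq_fun do rewrite cImM.
  by apply: measurable_funD; exact: measurable_funM.
Qed.

Lemma cmeasB f g : cmeas f -> cmeas g -> cmeas (fun x => f x - g x).
Proof.
move=> mf mg; have := cmeasD mf (cmeasM (cmeas_cst (-1)) mg).
by under eq_fun do rewrite mulN1r.
Qed.

Lemma cmeas_conj f : cmeas f -> cmeas (fun x => (f x)^*).
Proof.
move=> [fr fi]; split.
- by under eq_fun do rewrite Re_conj.
- by under eq_fun do rewrite Im_conj; exact: measurable_funN.
Qed.

Lemma cmeasX f n : cmeas f -> cmeas (fun x => f x ^+ n).
Proof.
move=> mf; elim: n => [|n IH]; first exact: (cmeas_cst 1).
by under eq_fun do rewrite exprS; exact: cmeasM.
Qed.

Lemma cmeas_sum (I : Type) (r : seq I) (F : I -> T -> R[i]) :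
  (forall i, cmeas (F i)) -> cmeas (fun x => \sum_(i <- r) F i x).
Proof.
move=> mF; elim: r => [|i r IH].
  by under eq_fun do rewrite big_nil; exact: (cmeas_cst 0).
by under eq_fun do rewrite big_cons; exact: cmeasD.
Qed.

Lemma cmeas_cvg (F : nat -> T -> R[i]) f : (forall n, cmeas (F n)) ->
  (forall x, D x -> ccvg (F ^~ x) (f x)) -> cmeas f.
Proof.
move=> mF Ff; split.
- apply: (@measurable_fun_cvg _ _ _ _ (fun n x => complex.Re (F n x))).
    by move=> n; have [] := mF n.
  by move=> x Dx; exact/ccvg_Re/Ff.
- apply: (@measurable_fun_cvg _ _ _ _ (fun n x => complex.Im (F n x))).
    by move=> n; have [] := mF n.
  by move=> x Dx; exact/ccvg_Im/Ff.
Qed.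

Lemma cmeas_real w : measurable_fun D w -> cmeas (fun x => (w x)%:C).
Proof. by move=> mw; split => //=; exact: measurable_cst. Qed.

Lemma measurable_normc f : cmeas f -> measurable_fun D (fun x => normc (f x)).
Proof.
move=> [fr fi].
rewrite (_ : (fun x => _) = (@powR R ^~ 2^-1) \o
   (fun x => complex.Re (f x) ^+ 2 + complex.Im (f x) ^+ 2)); last first.
  apply/funext => x /=; rewrite powR12_sqrt ?addr_ge0 ?sqr_ge0//.
  by case: (f x).
apply: measurableT_comp; first exact: measurable_powR.
by apply: measurable_funD; apply: measurable_funX.
Qed.

Lemma measurable_normc_powR f p : cmeas f ->
  measurable_fun D (fun x => normc (f x) `^ p).
Proof.
move=> mf; apply: (measurableT_comp (measurable_powR p)); exact: measurable_normc.
Qed.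

Lemma le_integrable_real w w' : measurable_fun D w ->
  (forall x, D x -> `|w x| <= w' x) -> mu.-integrable D (EFin \o w') ->
  mu.-integrable D (EFin \o w).
Proof.
move=> mw ww'; apply: le_integrable => //; first exact/measurable_EFinP.
by move=> x Dx /=; rewrite lee_fin (le_trans (ww' x Dx))// ler_norm.
Qed.

Lemma cintegrable_le f w : cmeas f -> (forall x, D x -> normc (f x) <= w x) ->
  mu.-integrable D (EFin \o w) -> cintegrable f.
Proof.
move=> [fr fi] fw iw; split.
- apply: le_integrable_real iw => // x Dx.
  exact: le_trans (Re_le_normc _) (fw _ Dx).
- apply: le_integrable_real iw => // x Dx.
  exact: le_trans (Im_le_normc _) (fw _ Dx).
Qed.

Lemma cintegrable_meas f : cintegrable f -> cmeas f.
Proof.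
by move=> [/(measurable_int mu) fr /(measurable_int mu) fi]; split; apply/measurable_EFinP.
Qed.

Lemma integrable_normc f : cintegrable f ->
  mu.-integrable D (EFin \o (fun x => normc (f x))).
Proof.
move=> jf; have [fr fi] := jf.
apply: (@le_integrable_real _ (fun x => `|complex.Re (f x)| + `|complex.Im (f x)|)).
- exact/measurable_normc/cintegrable_meas.
- by move=> x _; rewrite ger0_norm ?normc_ge0 ?normc_le_ReIm.
- exact: (integrableD mD (integrable_norm fr) (integrable_norm fi)).
Qed.

Lemma cintegrableD f g : cintegrable f -> cintegrable g ->
  cintegrable (fun x => f x + g x).
Proof.
move=> [fr fi] [gr gi]; split.
- by have := integrableD mD fr gr; apply: eq_integrable => // x _ /=; rewrite cReD.
- by have := integrableD mD fi gi; apply: eq_integrable => // x _ /=; rewrite cImD.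
Qed.

Lemma cintegrableZ z f : cintegrable f -> cintegrable (fun x => z * f x).
Proof.
move=> jf; apply: (@cintegrable_le _ (fun x => normc z * normc (f x))).
- by apply: cmeasM; [exact: cmeas_cst|exact: cintegrable_meas].
- by move=> x _; rewrite normcM.
- by have := integrableZl mD (normc z) (integrable_normc jf).
Qed.

Lemma cintD f g : cintegrable f -> cintegrable g ->
  cint (fun x => f x + g x) = cint f + cint g.
Proof.
move=> [fr fi] [gr gi]; apply: eqcP => /=.
- by rewrite -RintegralD//; apply: eq_Rintegral => x _; rewrite cReD.
- by rewrite -RintegralD//; apply: eq_Rintegral => x _; rewrite cImD.
Qed.

Lemma cintZ z f : cintegrable f -> cint (fun x => z * f x) = z * cint f.
Proof.
case: z => a b [fr fi].
have iZ (c : R) w : mu.-integrable D (EFin \o w) ->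
    mu.-integrable D (EFin \o (fun x => c * w x)).
  by move=> iw; exact: (integrableZl mD c iw).
apply: eqcP; rewrite ?cReM ?cImM /=.
- rewrite -!RintegralZl// -RintegralB//; try exact: iZ.
  by apply: eq_Rintegral => x _; rewrite cReM.
- rewrite -!RintegralZl// -RintegralD//; try exact: iZ.
  by apply: eq_Rintegral => x _; rewrite cImM.
Qed.

Lemma cintB f g : cintegrable f -> cintegrable g ->
  cint (fun x => f x - g x) = cint f - cint g.
Proof.
move=> jf jg; have := cintD jf (cintegrableZ (-1) jg).
by rewrite cintZ// mulN1r => <-; under eq_fun do rewrite -[- g _]mulN1r.
Qed.

Lemma eq_cint f g : {in D, f =1 g} -> cint f = cint g.
Proof. by move=> fg; apply: eqcP; apply: eq_Rintegral => x Dx; rewrite fg. Qed.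

Lemma eq_cintegrable f g : {in D, f =1 g} -> cintegrable f -> cintegrable g.
Proof.
move=> fg [fr fi]; split.
- by apply: eq_integrable fr => // x Dx /=; rewrite fg.
- by apply: eq_integrable fi => // x Dx /=; rewrite fg.
Qed.

Lemma cint0 : cint (cst 0) = 0.
Proof. by apply: eqcP; rewrite /= Rintegral_cst// mul0r. Qed.

Lemma cintegrable0 : cintegrable (cst 0).
Proof. by split; exact: integrable0. Qed.

Lemma cintegrable_sum (I : Type) (r : seq I) (F : I -> T -> R[i]) :
  (forall i, cintegrable (F i)) -> cintegrable (fun x => \sum_(i <- r) F i x).
Proof.
move=> mF; elim: r => [|i r IH].
  by under eq_fun do rewrite big_nil; exact: cintegrable0.
by under eq_fun do rewrite big_cons; exact: cintegrableD.
Qed.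

Lemma cint_sum (I : Type) (r : seq I) (F : I -> T -> R[i]) :
  (forall i, cintegrable (F i)) ->
  cint (fun x => \sum_(i <- r) F i x) = \sum_(i <- r) cint (F i).
Proof.
move=> mF; elim: r => [|i r IH].
  by under eq_fun do rewrite big_nil; rewrite big_nil cint0.
under eq_fun do rewrite big_cons.
by rewrite cintD ?big_cons ?IH//; exact: cintegrable_sum.
Qed.

Lemma cint_conj f : cintegrable f -> cint (fun x => (f x)^*) = (cint f)^*.
Proof.
move=> [fr fi]; apply: eqcP => /=.
  by apply: eq_Rintegral => x _; case: (f x).
rewrite -mulN1r -RintegralZl//; apply: eq_Rintegral => x _.
by rewrite mulN1r; case: (f x).
Qed.

Lemma normc_cint_le f : cintegrable f ->
  normc (cint f) <= 2 * \int[mu]_(x in D) normc (f x).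
Proof.
move=> jf; have [fr fi] := jf; have inorm := integrable_normc jf.
apply: le_trans (normc_le_ReIm _) _; rewrite mulrDl mul1r; apply: lerD => /=.
- apply: le_trans (le_normr_Rintegral _ _) _ => //.
  apply: le_Rintegral => //; first exact: integrable_norm.
  by move=> x _; exact: Re_le_normc.
- apply: le_trans (le_normr_Rintegral _ _) _ => //.
  apply: le_Rintegral => //; first exact: integrable_norm.
  by move=> x _; exact: Im_le_normc.
Qed.

Lemma Re_cint_le f w : cintegrable f -> mu.-integrable D (EFin \o w) ->
  (forall x, D x -> complex.Re (f x) <= w x) ->
  complex.Re (cint f) <= \int[mu]_(x in D) w x.
Proof. by move=> [fr fi] iw fw; exact: le_Rintegral. Qed.

(** Fatou's lemma for the nonnegative functions w_n - v_n. Only an upper bound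
    of the integrals of the dominating functions is required, which is what the
    dilation estimate [Lp_dilation] provides. *)
Lemma Rintegral_cvg0 (v w_ : nat -> T -> R) w (W : nat -> R) :
  (forall n, measurable_fun D (v n)) ->
  (forall n x, D x -> 0 <= v n x <= w_ n x) ->
  (forall x, D x -> v n x @[n --> \oo] --> (0 : R)) ->
  (forall x, D x -> w_ n x @[n --> \oo] --> w x) ->
  (forall n, mu.-integrable D (EFin \o w_ n)) ->
  mu.-integrable D (EFin \o w) ->
  (forall n, \int[mu]_(x in D) w_ n x <= W n) ->
  W n @[n --> \oo] --> \int[mu]_(x in D) w x ->
  \int[mu]_(x in D) v n x @[n --> \oo] --> (0 : R).
Proof.
move=> mv vw v0 ww iw_ iw wW Ww.
have iv n : mu.-integrable D (EFin \o v n).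
  apply: le_integrable_real (iw_ n) => // x Dx.
  by have /andP[a b] := vw n x Dx; rewrite ger0_norm.
set I := \int[mu]_(x in D) w x; set V := fun n => \int[mu]_(x in D) v n x.
have V0 n : 0 <= V n by apply: Rintegral_ge0 => x /(vw n) /andP[].
pose h n x := w_ n x - v n x.
have fatouI : (I%:E <= limn_einf (fun n => (W n - V n)%:E))%E.
  have mh n : measurable_fun D (fun x => (h n x)%:E).
    apply/measurable_EFinP/measurable_funB => //.
    by apply/measurable_EFinP; exact: (measurable_int mu (iw_ n)).
  have h0 n x : D x -> (0 <= (h n x)%:E)%E.
    by move=> Dx; rewrite lee_fin subr_ge0; have /andP[] := vw n x Dx.
  have := fatou mu mD mh h0.
  have -> : (\int[mu]_(x in D) limn_einf (fun n => (h n x)%:E) = I%:E)%E.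
    rewrite /I /Rintegral fineK; last exact: integrable_fin_num.
    apply: eq_integral => x /[!inE] Dx.
    have hw : (h n x)%:E @[n --> \oo] --> (w x)%:E.
      apply: cvg_EFin; first by near=> n.
      by rewrite -[w x]subr0; apply: cvgB; [exact: ww|exact: v0].
    by have [] := cvg_limn_einf_sup hw.
  move=> /le_trans; apply; rewrite !limn_einf_lim.
  apply: lee_lim; [exact: is_cvg_einfs|exact: is_cvg_einfs|].
  apply: nearW => n; apply: le_ereal_inf_tmp => _ [m /= nm <-].
  apply: le_trans (_ : (\int[mu]_(x in D) (h m x)%:E <= _)%E).
    by apply: ereal_inf_lbound; exists m.
  have -> : (\int[mu]_(x in D) (h m x)%:E =
      (\int[mu]_(x in D) (h m x))%:E)%E.
    rewrite /Rintegral fineK//; apply: integrable_fin_num => //.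
    exact: (integrableB mD (iw_ m) (iv m)).
  by rewrite lee_fin RintegralB// lerD2r.
apply/cvgrPdist_lt => e e0.
have e2 : 0 < e / 2 by rewrite divr_gt0.
have near1 : \forall n \near \oo, I - e / 2 < W n - V n.
  have cv := @cvg_einfs_sup R (fun n => (W n - V n)%:E).
  have : ((I - e / 2)%:E < ereal_sup (range (einfs (fun n => (W n - V n)%:E))))%E.
    rewrite -(cvg_lim _ cv)// -limn_einf_lim; apply: lt_le_trans fatouI.
    by rewrite lte_fin ltrBlDr ltrDl.
  move=> /ereal_sup_gt[_ [N _ <-] hN].
  exists N => // n /= Nn; rewrite -lte_fin; apply: lt_le_trans hN _.
  by apply: ereal_inf_lbound; exists n.
have near2 : \forall n \near \oo, W n < I + e / 2.
  by apply: (cvgr_lt _ Ww); rewrite ltrDl.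
near=> n; rewrite sub0r normrN ger0_norm//.
have h1 : I - e / 2 < W n - V n by near: n.
have h2 : W n < I + e / 2 by near: n.
rewrite -/(V n); lra.
Unshelve. all: by end_near. Qed.

(** Dominated convergence with varying dominating functions: the dilates of a
    function of A^p have bounded norms, but no integrable majorant is at hand. *)
Lemma cint_cvg (F : nat -> T -> R[i]) f (w_ : nat -> T -> R) w (W : nat -> R) :
  (forall n, cmeas (F n)) -> cintegrable f ->
  (forall x, D x -> ccvg (F ^~ x) (f x)) ->
  (forall n x, D x -> normc (F n x - f x) <= w_ n x) ->
  (forall x, D x -> w_ n x @[n --> \oo] --> w x) ->
  (forall n, mu.-integrable D (EFin \o w_ n)) ->
  mu.-integrable D (EFin \o w) ->
  (forall n, \int[mu]_(x in D) w_ n x <= W n) ->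
  W n @[n --> \oo] --> \int[mu]_(x in D) w x ->
  ccvg (fun n => cint (F n)) (cint f).
Proof.
move=> mF jf Ff Fw ww iw_ iw wW Ww.
have mf := cintegrable_meas jf.
have jFf n : cintegrable (fun x => F n x - f x).
  by apply: cintegrable_le (Fw n) (iw_ n); exact: cmeasB.
have jF n : cintegrable (F n).
  by have := cintegrableD (jFf n) jf; under eq_fun do rewrite subrK.
apply: (@ccvg_squeeze _ _ _ (fun n => 2 * \int[mu]_(x in D) normc (F n x - f x))).
  by move=> n; rewrite -cintB//; exact: normc_cint_le.
rewrite -(mulr0 2); apply: cvgM; first exact: cvg_cst.
apply: (@Rintegral_cvg0 _ w_ w W) => //.
- by move=> n; apply: measurable_normc; exact: cintegrable_meas.
- by move=> n x Dx; rewrite normc_ge0 Fw.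
Qed.

Lemma cint_dominated_cvg (F : nat -> T -> R[i]) f w :
  (forall n, cmeas (F n)) ->
  (forall x, D x -> ccvg (F ^~ x) (f x)) ->
  (forall n x, D x -> normc (F n x) <= w x) ->
  mu.-integrable D (EFin \o w) ->
  cintegrable f /\ ccvg (fun n => cint (F n)) (cint f).
Proof.
move=> mF Ff Fw iw.
have fw x : D x -> normc (f x) <= w x.
  move=> Dx; rewrite -[f x]subr0; apply: (@ccvg_le _ _ _ _ _ 0%N (Ff x Dx)) => n _.
  by rewrite subr0 Fw.
have jf : cintegrable f.
  by apply: cintegrable_le fw iw; exact: cmeas_cvg Ff.
have iw2 : mu.-integrable D (EFin \o (fun x => 2 * w x)).
  exact: (integrableZl mD 2 iw).
split => //.
apply: (@cint_cvg _ _ (fun n x => 2 * w x) (fun x => 2 * w x)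
  (fun=> \int[mu]_(x in D) (2 * w x))) => //.
- by move=> n x Dx; rewrite (le_trans (ler_normcB _ _))// mulr_natl mulr2n lerD// ?Fw// fw.
- by move=> x _; exact: cvg_cst.
- exact: cvg_cst.
Qed.

End ComplexIntegral.

(** * Linear changes of variables in the plane *)

Section AreaMaps.
Variable R : realType.
Local Notation mR := (measurableTypeR R).
Local Notation lam := (@lebesgue_measure R).

(** The image measure packaged together with its measure structure, which
    depends on the measurability of the map. *)
Definition image_measure d d' (T1 : measurableType d) (T2 : measurableType d')
    (m : {measure set T1 -> \bar R}) (f : T1 -> T2)
    (mf : measurable_fun [set: T1] f) : {measure set T2 -> \bar R} :=
  measure_function_pushforward__canonical__measure_function_Measure m mf.

Lemma measurable_affine (a c : R) :
  measurable_fun [set: mR] (fun x : mR => a * x + c : mR).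
Proof.
by apply: measurable_funD; [exact: mulrl_measurable|exact: measurable_cst].
Qed.

Lemma lebesgue_measure_affine (a c : R) (A : set mR) : 0 < a -> measurable A ->
  lam ((fun x : mR => a * x + c : mR) @^-1` A) = (a^-1%:E * lam A)%E.
Proof.
move=> a0 mA.
pose m : {measure set mR -> \bar R} :=
  mscale (NngNum (ltW a0)) (image_measure lam (measurable_affine a c)).
have -> : lam A = m A.
  apply: lebesgue_measure_unique => // _ [[u v]] _ <-.
  rewrite /m /= /mscale /= /pushforward.
  have -> : (fun x : mR => a * x + c : mR) @^-1` `]u, v]%classic =
     `](u - c) / a, (v - c) / a]%classic.
    apply/seteqP; split => x /=; rewrite !in_itv/=.
      by rewrite ltr_pdivrMr// ler_pdivlMr// ltrBlDr lerBrDr mulrC.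
    by rewrite ltr_pdivrMr// ler_pdivlMr// ltrBlDr lerBrDr mulrC.
  rewrite !lebesgue_measure_itv/= !lte_fin ltr_pM2r ?invr_gt0// ltrD2r.
  case: ifPn => _; rewrite ?mule0//.
  by rewrite -!EFinD -EFinM; congr EFin; field; rewrite gt_eqF.
rewrite /m /= /mscale /= /pushforward muleA -EFinM mulVf ?mul1e//.
by rewrite gt_eqF.
Qed.

Definition scales_area (T : R2 R -> R2 R) (k : R) :=
  measurable_fun setT T /\
  forall A, measurable A -> area R (T @^-1` A) = (k%:E * area R A)%E.

Lemma area_ysection (A : set (R2 R)) : measurable A ->
  area R A = (lam \x^ lam)%E A.
Proof.
move=> mA; apply: product_measure_unique => // B C mB mC.
by rewrite [LHS]product_measure2E.
Qed.

(** By Fubini, from the affine case on each horizontal line. *)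
Lemma scales_area_shearl (a b : R) : 0 < a ->
  scales_area (fun x => (a * x.1 + b * x.2, x.2)) a^-1.
Proof.
move=> a0; have mT : measurable_fun setT (fun x : R2 R => (a * x.1 + b * x.2, x.2) : R2 R).
  apply: measurable_fun_pair => /=; last exact: measurable_snd.
  apply: measurable_funD; apply: measurable_funM => //.
split => // A mA.
have mTA : measurable ((fun x : R2 R => (a * x.1 + b * x.2, x.2) : R2 R) @^-1` A).
  by rewrite -[X in measurable X]setTI; exact: mT.
rewrite !area_ysection// /product_measure2 /=.
rewrite -ge0_integralZl//; last 2 first.
- exact: measurable_fun_ysection.
- by rewrite lee_fin invr_ge0 ltW.
apply: eq_integral => y _ /=.
rewrite -(@lebesgue_measure_affine a (b * y))//; last exact: measurable_ysection.
Qed.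

Lemma scales_area_shearr (a b : R) : 0 < a ->
  scales_area (fun x => (x.1, a * x.2 + b * x.1)) a^-1.
Proof.
move=> a0; have mT : measurable_fun setT (fun x : R2 R => (x.1, a * x.2 + b * x.1) : R2 R).
  apply: measurable_fun_pair => /=; first exact: measurable_fst.
  apply: measurable_funD; apply: measurable_funM => //.
split => // A mA.
have mTA : measurable ((fun x : R2 R => (x.1, a * x.2 + b * x.1) : R2 R) @^-1` A).
  by rewrite -[X in measurable X]setTI; exact: mT.
rewrite /area /= /product_measure1 /=.
rewrite -ge0_integralZl//; last 2 first.
- exact: measurable_fun_xsection.
- by rewrite lee_fin invr_ge0 ltW.
apply: eq_integral => y _ /=.
rewrite -(@lebesgue_measure_affine a (b * y))//; last exact: measurable_xsection.
Qed.

Lemma scales_area_comp S T k l : scales_area S k -> scales_area T l ->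
  scales_area (S \o T) (k * l).
Proof.
move=> [mS hS] [mT hT]; split; first exact: measurableT_comp.
move=> A mA; have mSA : measurable (S @^-1` A).
  by rewrite -[X in measurable X]setTI; exact: mS.
by rewrite (_ : (S \o T) @^-1` A = T @^-1` (S @^-1` A))// hT// hS// muleA -EFinM [l * k]mulrC.
Qed.

(** Multiplication by z in the real coordinates of the plane. *)
Definition cmulT (z : R[i]) (x : R2 R) : R2 R :=
  (complex.Re z * x.1 - complex.Im z * x.2, complex.Re z * x.2 + complex.Im z * x.1).

Lemma plane_cmulT z x : plane (cmulT z x) = z * plane x.
Proof. by apply: eqcP; rewrite ?cReM ?cImM. Qed.

Lemma scales_area_dilation (r : R) : 0 < r -> scales_area (cmulT r%:C) (r ^- 2).
Proof.
move=> r0; have := scales_area_comp (scales_area_shearl 0 r0) (scales_area_shearr 0 r0).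
rewrite -invfM expr2; congr scales_area; apply/funext => x.
by rewrite /cmulT /=; congr pair; ring.
Qed.

(** The rotation by an angle t is the product of the shears of coefficients
    -tan(t/2), sin t and -tan(t/2), where tan(t/2) = s / (1 + c). *)
Lemma scales_area_rotation (c s : R) : c ^+ 2 + s ^+ 2 = 1 -> 0 <= c ->
  scales_area (cmulT (c +i* s)) 1.
Proof.
move=> cs c0; have c1 : 1 + c != 0 by rewrite gt_eqF//; lra.
pose t := - (s / (1 + c)).
have sl := scales_area_shearl t (@ltr01 R); have sr := scales_area_shearr s (@ltr01 R).
have := scales_area_comp sl (scales_area_comp sr sl).
rewrite invr1 !mul1r; congr scales_area; apply/funext => x.
(* c^2 + s^2 = 1 and t = -s/(1+c) give 1 + t s = c. *)
have E1 : 1 + t * s = c.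
  by rewrite /t; apply: (mulIf c1); rewrite mulrDl mulNr mulNr mulrAC divfK//; lra.
have E2 : t * (1 + c) = - s by rewrite /t mulNr divfK.
rewrite /cmulT /=; congr pair; last by rewrite -E1; ring.
have -> : 1 * (1 * x.1 + t * x.2) + t * (1 * x.2 + s * (1 * x.1 + t * x.2)) =
  (1 + t * s) * x.1 + t * (1 + (1 + t * s)) * x.2 by ring.
by rewrite E1 E2 mulNr.
Qed.

Lemma scales_sigma T k A : scales_area T k -> measurable A ->
  sigma R (T @^-1` A) = (k%:E * sigma R A)%E.
Proof. by move=> [_ hT] mA; rewrite /sigma /= /mscale /= hT// muleCA. Qed.

Lemma ge0_integral_scales T k D (f : R2 R -> \bar R) :
  scales_area T k -> 0 <= k -> measurable D -> measurable_fun D f ->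
  (forall x, D x -> 0 <= f x)%E ->
  (\int[sigma R]_(x in T @^-1` D) f (T x) = k%:E * \int[sigma R]_(x in D) f x)%E.
Proof.
move=> hT k0 mD mf f0; have [mT _] := hT.
rewrite -[LHS](@ge0_integral_pushforward _ _ _ _ _ T mT (sigma R) D f)//; last first.
  by move=> x /[!inE]; exact: f0.
rewrite -(@ge0_integral_mscale _ _ _ (sigma R) D mD (NngNum k0) f)//.
apply: (@eq_measure_integral _ _ _ _ (mscale (NngNum k0) (sigma R)) (image_measure (sigma R) mT)) => A mA _.
by rewrite /= /pushforward /mscale /= -(scales_sigma hT mA).
Qed.

Lemma Rintegral_isometry T D (f : R2 R -> R) :
  scales_area T 1 -> measurable D -> T @^-1` D = D ->
  measurable_fun setT f -> (sigma R).-integrable D (EFin \o (f \o T)) ->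
  \int[sigma R]_(x in D) f (T x) = \int[sigma R]_(x in D) f x.
Proof.
move=> hT mD TD mf jf; have [mT _] := hT; congr fine.
have jf' : (sigma R).-integrable (T @^-1` D) ((EFin \o f) \o T) by rewrite TD.
have mEf : measurable_fun setT (EFin \o f) by exact/measurable_EFinP.
have E1 := integral_pushforward mT mEf jf' mD.
rewrite TD in E1; rewrite -[LHS]E1.
apply: (@eq_measure_integral _ _ _ _ (sigma R) (image_measure (sigma R) mT)) => A mA _.
by rewrite /= /pushforward (scales_sigma hT mA) mul1e.
Qed.

End AreaMaps.

(** * Monomials and power series on the disc *)

Section DiscMoments.
Variable R : realType.
Local Notation mD := (@measurable_pdisc R).
Local Notation dint := (cint (sigma R) (@pdisc R)).
Local Notation dintegrable := (cintegrable (sigma R) (@pdisc R)).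
Local Notation dmeas := (cmeas (@pdisc R)).

Lemma pdiscP (x : R2 R) : pdisc x <-> normc (plane x) < 1.
Proof. by []. Qed.

Lemma cmeas_plane (D : set (R2 R)) : cmeas D (@plane R).
Proof.
split => /=; apply: measurable_funTS; [exact: measurable_fst|exact: measurable_snd].
Qed.

Lemma integrable_cst_pdisc (c : R) : (sigma R).-integrable (@pdisc R) (EFin \o cst c).
Proof.
apply: measurable_bounded_integrable => //; first exact: mD.
- by rewrite [X in (X < _)%E]sigma_pdisc ltry.
- by exists `|c|; split; [exact: num_real|move=> M cM x _ /=; exact: ltW].
Qed.

Lemma dintegrable_bounded f (B : R) : dmeas f ->
  (forall x, pdisc x -> normc (f x) <= B) -> dintegrable f.
Proof. by move=> mf fB; exact: (cintegrable_le mD mf fB (integrable_cst_pdisc B)). Qed.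

Definition monom (n m : nat) (x : R2 R) : R[i] := plane x ^+ n * (plane x)^* ^+ m.

Lemma cmeas_monom D n m : cmeas D (monom n m).
Proof.
by apply: cmeasM; apply: cmeasX; [|apply: cmeas_conj]; exact: cmeas_plane.
Qed.

Lemma monom_le1 n m x : pdisc x -> normc (monom n m x) <= 1.
Proof.
move=> /pdiscP /ltW x1.
rewrite /monom normcM !normcX normc_conj -(mulr1 1) ler_pM ?exprn_ge0 ?normc_ge0//.
- by rewrite exprn_ile1 ?normc_ge0.
- by rewrite exprn_ile1 ?normc_ge0.
Qed.

Lemma dintegrable_monom n m : dintegrable (monom n m).
Proof. by apply: dintegrable_bounded (@monom_le1 n m); exact: cmeas_monom. Qed.

Lemma cmulT_preimage_pdisc z : normc z = 1 -> cmulT z @^-1` @pdisc R = @pdisc R.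
Proof.
by move=> z1; apply/seteqP; split => x; rewrite /= !pdiscP plane_cmulT normcM z1 mul1r.
Qed.

Lemma de_moivre (t : R) k : (cos t +i* sin t) ^+ k = cos (k%:R * t) +i* sin (k%:R * t).
Proof.
elim: k => [|k IH]; first by rewrite mul0r cos0 sin0.
by rewrite exprS IH -natr1 mulrDl mul1r addrC cosD sinD; apply: eqcP => /=; ring.
Qed.

Lemma dint_rotation (c s : R) n m : c ^+ 2 + s ^+ 2 = 1 -> 0 <= c ->
  (c +i* s) ^+ n * (c +i* s)^* ^+ m * dint (monom n m) = dint (monom n m).
Proof.
move=> cs c0; set z := c +i* s.
have z1 : normc z = 1 by rewrite /z /= cs sqrtr1.
have hT := scales_area_rotation cs c0.
have TD := cmulT_preimage_pdisc z1.
rewrite -cintZ; [|exact: mD|exact: dintegrable_monom].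
have E x : monom n m (cmulT z x) = z ^+ n * z^* ^+ m * monom n m x.
  by rewrite /monom plane_cmulT rmorphM !exprMn mulrACA.
transitivity (dint (fun x => monom n m (cmulT z x))).
  by apply: eq_cint => x _; rewrite E.
have jT : dintegrable (fun x => monom n m (cmulT z x)).
  under eq_fun do rewrite E.
  apply: cintegrableZ; [exact: mD|exact: dintegrable_monom].
have [mr mi] := @cmeas_monom setT n m.
by apply: eqcP; apply: Rintegral_isometry => //; [exact: mD|by case: jT|exact: mD|by case: jT].
Qed.

(** The rotation by pi/(2k) multiplies w^(n+k) conj(w)^n by i, and leaves the
    integral unchanged. The angle is at most pi/2, in the range of
    [scales_area_rotation]. *)
Lemma dint_monom_gt n k : (0 < k)%N -> dint (monom (n + k) n) = 0.
Proof.
move=> k0; pose t : R := pi / 2 / k%:R.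
have k0' : 0 < k%:R :> R by rewrite ltr0n.
have t0 : 0 <= t by rewrite !divr_ge0// ?pi_ge0// ltW.
have t1 : t <= pi / 2.
  by rewrite ler_pdivrMr// ler_peMr ?divr_ge0 ?pi_ge0// ler1n.
have ct : 0 <= cos t.
  by apply: cos_ge0_pihalf; rewrite t1 andbT (le_trans _ t0)// oppr_le0 divr_ge0 ?pi_ge0.
have := @dint_rotation (cos t) (sin t) (n + k) n (cos2Dsin2 t) ct.
set z := _ +i* _; rewrite exprD [_ * z ^+ k]mulrC -[z ^+ k * _ * _]mulrA -exprMn.
have -> : z * z^* = 1.
  by apply: eqcP => /=; rewrite ?mulrN ?opprK -?expr2 ?cos2Dsin2//; ring.
rewrite expr1n mulr1 de_moivre (_ : k%:R * t = pi / 2); last first.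
  by rewrite /t mulrC divfK// gt_eqF.
rewrite cos_pihalf sin_pihalf => E.
apply/eqP; have /eqP := E; rewrite -subr_eq0 -[X in _ - X]mul1r -mulrBl mulf_eq0.
by case/orP => // /eqP [] /eqP; rewrite sub0r oppr_eq0 oner_eq0.
Qed.

Lemma dint_monom_neq n m : n != m -> dint (monom n m) = 0.
Proof.
rewrite neq_ltn => /orP[nm|mn]; last first.
  by rewrite -(subnKC (ltnW mn)) dint_monom_gt// subn_gt0.
have -> : dint (monom n m) = (dint (monom m n))^*.
  rewrite -cint_conj; [|exact: mD|exact: dintegrable_monom].
  apply: eq_cint => x _; by rewrite /monom conjcM !conjcX conjcK mulrC.
by rewrite -(subnKC (ltnW nm)) dint_monom_gt ?subn_gt0// conjc0.
Qed.

Lemma exprn_limit1_le n (a b : R) : 0 <= a ->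
  (forall x, 0 < x < 1 -> x ^+ n * a <= b) -> a <= b.
Proof.
move=> a0 h; rewrite leNgt; apply/negP => ba.
have a1 : 0 < a.
  rewrite lt_def a0 andbT; apply/eqP => a00.
  have := h (1 / 2) ltac:(lra); rewrite a00 mulr0; lra.
have cv : x ^+ n * a @[x --> 1^'-] --> a.
  rewrite -[X in _ --> X]mul1r -[X in X * a](expr1n _ n).
  apply: cvgM; last exact: cvg_cst.
  by apply: cvg_at_left_filter; exact: exprn_continuous.
have : a <= b.
  apply: (cvgr_to_le cv); near=> x; apply: h; apply/andP; split => //.
by rewrite leNgt ba.
Unshelve. all: by end_near. Qed.

Definition subdisc (r : R) : set (R2 R) := [set x | normc (plane x) < r].

Lemma measurable_subdisc r : measurable (subdisc r).
Proof.
have := measurable_normc (cmeas_plane setT).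
move=> /(_ measurableT _ (measurable_itv `]-oo, r[)); rewrite setTI.
by congr measurable; apply/seteqP; split => x /=; rewrite in_itv.
Qed.

Lemma subdisc_pdisc r : r <= 1 -> subdisc r `<=` @pdisc R.
Proof. by move=> r1 x; rewrite /= pdiscP => /lt_le_trans; apply. Qed.

Lemma dilation_preimage_subdisc r : 0 < r -> cmulT r%:C @^-1` subdisc r = @pdisc R.
Proof.
move=> r0; apply/seteqP; split => x; rewrite /preimage /subdisc /mkset ?pdiscP plane_cmulT normcM normc_real gtr0_norm//.
  by rewrite -{2}(mulr1 r) ltr_pM2l.
by move=> h; rewrite -{2}(mulr1 r) ltr_pM2l.
Qed.

Definition radial n (x : R2 R) : R := (normc (plane x) ^+ 2) ^+ n.

Lemma measurable_radial D n : measurable_fun D (radial n).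
Proof.
by do 2 apply: measurable_funX; apply: measurable_normc; exact: cmeas_plane.
Qed.

Lemma radial_ge0 n x : 0 <= radial n x.
Proof. by rewrite /radial exprn_ge0// sqr_ge0. Qed.

Lemma radial_le1 n x : pdisc x -> radial n x <= 1.
Proof.
move=> /pdiscP/ltW h; rewrite /radial exprn_ile1 ?sqr_ge0//.
by rewrite exprn_ile1 ?normc_ge0.
Qed.

Lemma integrable_radial n : (sigma R).-integrable (@pdisc R) (EFin \o radial n).
Proof.
apply: (le_integrable_real mD _ _ (integrable_cst_pdisc 1)); first exact: measurable_radial.
by move=> x Dx; rewrite ger0_norm ?radial_ge0 ?radial_le1.
Qed.

Definition moment n := \int[sigma R]_(x in @pdisc R) radial n x.

Lemma moment0 : moment 0 = 1.
Proof. by rewrite /moment /radial Rintegral_cst ?sigma_pdisc ?mul1r//; exact: mD. Qed.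

(** Change of variables w = r w'. *)
Lemma moment_subdisc n r : 0 < r -> r <= 1 ->
  \int[sigma R]_(x in subdisc r) radial n x = (r ^+ 2) ^+ n.+1 * moment n.
Proof.
move=> r0 r1; have j : (sigma R).-integrable (subdisc r) (EFin \o radial n).
  apply: integrableS (integrable_radial n); [exact: mD|exact: measurable_subdisc|exact: subdisc_pdisc].
have := @ge0_integral_scales _ _ _ (subdisc r) (EFin \o radial n) (scales_area_dilation r0).
rewrite dilation_preimage_subdisc// => H.
have k0 : 0 <= r ^- 2 by rewrite invr_ge0 exprn_ge0// ltW.
have f0 x : subdisc r x -> (0 <= (EFin \o radial n) x)%E.
  by move=> _; rewrite lee_fin radial_ge0.
have mf : measurable_fun (subdisc r) (EFin \o radial n).
  by apply/measurable_EFinP; exact: measurable_radial.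
have {H} := congr1 fine (H k0 (measurable_subdisc r) mf f0).
rewrite fineM//; last by apply: integrable_fin_num => //; exact: measurable_subdisc.
move=> H.
have E : (r ^+ 2) ^+ n * moment n = r ^- 2 * \int[sigma R]_(x in subdisc r) radial n x.
  rewrite /moment -RintegralZl; [|exact: mD|exact: integrable_radial].
  rewrite -[RHS]H; congr fine; apply: eq_integral => x _ /=.
  rewrite /radial plane_cmulT normcM normc_real gtr0_norm//.
  by rewrite !exprMn mulrACA.
rewrite exprS -mulrA E.
by rewrite mulrA divff ?mul1r// expf_neq0// gt_eqF.
Qed.

(** On the annulus r <= |w| < 1 the integrand |w|^(2n) lies between r^(2n)
    and 1. By scaling, the integral over the annulus is (1 - x^(n+1)) times the
    moment, where x = r^2, and its area is 1 - x. Hence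
    x^n <= (1 + x + ... + x^n) moment <= 1, and x tends to 1. *)
Lemma momentE n : moment n = n.+1%:R^-1.
Proof.
have key x : 0 < x < 1 -> x ^+ n <= (\sum_(i < n.+1) x ^+ i) * moment n <= 1.
  move=> /andP[x0 x1]; pose r := Num.sqrt x.
  have r0 : 0 < r by rewrite sqrtr_gt0.
  have r1 : r <= 1 by rewrite -sqrtr1 ler_wsqrtr// ltW.
  have rx : r ^+ 2 = x by rewrite sqr_sqrtr// ltW.
  pose ann := @pdisc R `\` subdisc r.
  have mann : measurable ann by apply: measurableD; [exact: mD|exact: measurable_subdisc].
  have annD : ann `<=` @pdisc R by move=> y [].
  have jann k : (sigma R).-integrable ann (EFin \o radial k).
    by apply: integrableS (integrable_radial k) => //; exact: mD.
  have annE k : \int[sigma R]_(x in ann) radial k x = (1 - x ^+ k.+1) * moment k.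
    have U : subdisc r `|` ann = @pdisc R.
      apply/seteqP; split => [y [/(subdisc_pdisc r1)//|[]//]|y Dy].
      by have [yr|yr] := pselect (subdisc r y); [left|right].
    have := @Rintegral_setU _ _ _ (sigma R) (subdisc r) ann (radial k) (measurable_subdisc r) mann.
    rewrite U => /(_ (integrable_radial k)) H.
    rewrite mulrBl mul1r -{1}rx -moment_subdisc// {1}/moment H ?addrK//.
      by rewrite addrC addKr.
    by apply/disj_setPS => y [? []].
  have fac k : 1 - x ^+ k.+1 = (1 - x) * \sum_(i < k.+1) x ^+ i.
    by rewrite -[1 in LHS](expr1n _ k.+1) subrXX; congr (_ * _); apply: eq_bigr => i _; rewrite expr1n mul1r.
  have ann0 : \int[sigma R]_(x in ann) radial 0 x = 1 - x.
    by rewrite annE moment0 expr1 mulr1.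
  have x1' : 0 < 1 - x by rewrite subr_gt0.
  rewrite -(ler_pM2l x1') -[X in _ && X](ler_pM2l x1') mulrA -fac -annE mulr1 -ann0.
  apply/andP; split.
    rewrite mulrC -RintegralZl//; apply: le_Rintegral => //.
      exact: (integrableZl mann (x ^+ n) (jann 0%N)).
    move=> y [Dy /negP]; rewrite -leNgt => ry; rewrite /radial expr0 mulr1 -rx.
    by rewrite lerXn2r ?nnegrE ?exprn_ge0 ?normc_ge0 ?(ltW r0)// lerXn2r ?nnegrE ?normc_ge0 ?(ltW r0).
  apply: le_Rintegral => // y [Dy _]; rewrite {2}/radial expr0; exact: radial_le1.
have m0 : 0 <= moment n by apply: Rintegral_ge0 => x _; exact: radial_ge0.
have n0 : n.+1%:R != 0 :> R by rewrite pnatr_eq0.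
suff E : n.+1%:R * moment n = 1 by apply: (mulfI n0); rewrite E mulfV.
apply/eqP; rewrite eq_le; apply/andP; split.
- apply: (@exprn_limit1_le n); first by rewrite mulr_ge0.
  move=> x x01; have /andP[_] := key x x01; apply: le_trans.
  rewrite mulrA ler_wpM2r// mulrC mulr_natl.
  rewrite -{1}(card_ord n.+1) -sumr_const; apply: ler_sum => i _.
  by have /andP[x0 x1] := x01; rewrite ler_wiXn2l ?ltW// -ltnS.
- apply: (@exprn_limit1_le n) => // x x01; rewrite mulr1.
  have /andP[h _] := key x x01; apply: le_trans h _; rewrite ler_wpM2r//.
  have -> : n.+1%:R = \sum_(i < n.+1) (1 : R) by rewrite sumr_const card_ord.
  apply: ler_sum => i _.
  by have /andP[x0 x1] := x01; rewrite exprn_ile1 ?ltW.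
Qed.

Lemma dint_monom_diag n : dint (monom n n) = (n.+1%:R)^-1.
Proof.
have E x : monom n n x = (radial n x)%:C.
  rewrite /monom -exprMn /radial rmorphXn; congr (_ ^+ _).
  by apply: eqcP; case: (plane x) => a b /=; rewrite ?sqr_sqrtr ?addr_ge0 ?sqr_ge0//; ring.
have -> : dint (monom n n) = (moment n)%:C.
  apply: eqcP => /=.
    by apply: eq_Rintegral => x _; rewrite E.
  rewrite -[RHS](mul0r (fine (sigma R (@pdisc R)))) -Rintegral_cst; last exact: mD.
  by apply: eq_Rintegral => x _; rewrite E.
by rewrite momentE fmorphV rmorph_nat.
Qed.

Lemma dint_monom n m : dint (monom n m) = (n == m)%:R / (n.+1)%:R.
Proof.
case: eqVneq => [->|nm]; first by rewrite mul1r dint_monom_diag.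
by rewrite mul0r dint_monom_neq.
Qed.

Lemma dint_pseries a (s M : R) g : geo_bounded a s M -> 1 < s -> dintegrable g ->
  dintegrable (fun x => csum (fun n => a n * plane x ^+ n) * g x) /\
  ccvg (series (fun n => a n * dint (fun x => plane x ^+ n * g x)))
    (dint (fun x => csum (fun n => a n * plane x ^+ n) * g x)).
Proof.
move=> ha s1 jg; have s0 : 0 < s by rewrite (lt_trans _ s1).
have mg := cintegrable_meas jg.
pose t := s^-1; have t0 : 0 <= t by rewrite invr_ge0 ltW.
have t1 : t < 1 by rewrite invf_lt1.
pose F N x := series (fun n => a n * plane x ^+ n) N * g x.
have M0 : 0 <= M.
  by apply: le_trans (ha 0%N); rewrite mulr_ge0 ?normc_ge0 ?exprn_ge0// ltW.
have mF N : dmeas (F N).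
  apply: cmeasM => //; apply: cmeas_sum => n.
  apply: cmeasM; [exact: cmeas_cst|apply: cmeasX; exact: cmeas_plane].
have Ff x : pdisc x -> ccvg (F ^~ x) (csum (fun n => a n * plane x ^+ n) * g x).
  move=> /pdiscP x1; rewrite mulrC.
  have := ccvgZ (g x) (ccvg_pseries ha (lt_trans x1 s1)).
  by apply: eq_ccvg => N; rewrite mulrC.
have Fw N x : pdisc x -> normc (F N x) <= M / (1 - t) * normc (g x).
  move=> /pdiscP x1; rewrite /F normcM ler_wpM2r ?normc_ge0//.
  apply: le_trans (ler_normc_sum _ _ _) _.
  rewrite -[M]mulr1 -(expr0 t); apply: le_trans (sum_geo_le 0 N M0 t0 t1).
  apply: ler_sum => n _; rewrite normcM normcX.
  apply: le_trans (geo_bounded_le n ha s0 (normc_ge0 _)) _.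
  rewrite ler_wpM2l// lerXn2r ?nnegrE ?divr_ge0 ?normc_ge0 ?(ltW s0)//.
  by rewrite ler_pdivrMr// mulVf ?gt_eqF// ltW.
have jw : (sigma R).-integrable (@pdisc R) (EFin \o (fun x => M / (1 - t) * normc (g x))).
  exact: (integrableZl mD (M / (1 - t)) (integrable_normc mD jg)).
have [jS cv] := cint_dominated_cvg mD mF Ff Fw jw.
split => //; move: cv; apply: eq_ccvg => N.
have jn n : dintegrable (fun x => plane x ^+ n * g x).
  apply: (cintegrable_le mD _ _ (integrable_normc mD jg)).
    apply: cmeasM => //; apply: cmeasX; exact: cmeas_plane.
  move=> x /pdiscP x1; rewrite normcM normcX ler_piMl ?normc_ge0//.
  by rewrite exprn_ile1 ?normc_ge0// ltW.
rewrite /F /series /=.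
transitivity (dint (fun x => \sum_(0 <= n < N) a n * (plane x ^+ n * g x))).
  by apply: eq_cint => x _; rewrite mulr_suml; apply: eq_bigr => n _; rewrite mulrA.
rewrite cint_sum; [|exact: mD|by move=> n; apply: cintegrableZ => //; exact: mD].
by apply: eq_bigr => n _; rewrite cintZ//; exact: mD.
Qed.

Lemma dint_pseries_conj a (s M : R) m : geo_bounded a s M -> 1 < s ->
  dint (fun x => csum (fun n => a n * plane x ^+ n) * (plane x)^* ^+ m) =
  a m / m.+1%:R.
Proof.
move=> ha s1; have jm : dintegrable (fun x => (plane x)^* ^+ m).
  have := dintegrable_monom 0 m; apply: (eq_cintegrable mD) => x _.
  by rewrite /monom expr0 mul1r.
have [_ cv] := dint_pseries ha s1 jm.
apply: (ccvg_unique cv).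
apply: (@ccvg_squeeze _ _ _ (fun n => (n <= m)%:R * normc (a m / m.+1%:R))).
  move=> N; rewrite (_ : series _ N = (m < N)%:R * (a m / m.+1%:R)).
    case: ltnP => mN; rewrite ?mul1r ?subrr ?normc0 ?mul0r ?mul1r//.
    by rewrite sub0r normcN.
  rewrite /series /=.
  rewrite (eq_bigr (fun n => if n == m then a m / m.+1%:R else 0)); last first.
    move=> n _; rewrite -/(monom n m) [dint _]dint_monom.
    by case: eqVneq => [->|_]; rewrite ?mul0r ?mulr0// mul1r.
  rewrite -big_mkcond /= big_nat1_eq leq0n /=.
  by case: ltnP; rewrite ?mul1r ?mul0r.
apply: cvg_near_cst; exists m.+1 => // N /= mN.
by rewrite leqNgt mN mul0r.
Qed.

(** A Cauchy estimate, obtained by pairing the dilated series with w^m; the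
    extra factor 2 (m + 1) does not affect radii of convergence. *)
Lemma coef_estimate a (s M r B : R) m : geo_bounded a s M -> 0 < r -> r < s ->
  (forall z, normc z < r -> normc (csum (fun n => a n * z ^+ n)) <= B) ->
  normc (a m) * r ^+ m <= m.+1%:R * (2 * B).
Proof.
move=> ha r0 rs hB; pose b n := a n * r%:C ^+ n.
have s0 : 0 < s by apply: lt_trans rs.
have hb : geo_bounded b (s / r) M.
  move=> n; rewrite /b normcM normcX normc_real gtr0_norm// -mulrA -exprMn.
  by rewrite mulrC [r * _]mulrC divfK ?gt_eqF// mulrC.
have sr1 : 1 < s / r by rewrite ltr_pdivlMr// mul1r.
have E := dint_pseries_conj m hb sr1.
have bE x : csum (fun n => b n * plane x ^+ n) = csum (fun n => a n * (r%:C * plane x) ^+ n).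
  by congr csum; apply/funext => n; rewrite /b exprMn mulrA.
have jm : dintegrable (fun x => (plane x)^* ^+ m).
  have := dintegrable_monom 0 m; apply: (eq_cintegrable mD) => x _.
  by rewrite /monom expr0 mul1r.
have [jS _] := dint_pseries hb sr1 jm.
have : normc (b m / m.+1%:R) <= 2 * B.
  rewrite -E; apply: le_trans (normc_cint_le mD jS) _; rewrite ler_wpM2l//.
  have -> : B = \int[sigma R]_(x in @pdisc R) B.
    by rewrite Rintegral_cst ?sigma_pdisc ?mulr1//; exact: mD.
  apply: le_Rintegral; [exact: mD|exact: (integrable_normc mD jS)|exact: integrable_cst_pdisc|].
  move=> x /pdiscP x1; rewrite normcM normcX normc_conj bE.
  apply: le_trans (_ : normc (csum (fun n => a n * (r%:C * plane x) ^+ n)) * 1 <= _).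
    by rewrite ler_wpM2l ?normc_ge0// exprn_ile1 ?normc_ge0// ltW.
  rewrite mulr1; apply: hB; rewrite normcM normc_real gtr0_norm//.
  by rewrite -{2}(mulr1 r) ltr_pM2l.
rewrite normcM normcV normc_nat /b normcM normcX normc_real gtr0_norm//.
by rewrite ler_pdivrMr ?ltr0n// [X in _ <= X]mulrC.
Qed.

End DiscMoments.

(** * Analytic functions on the disc are sums of power series *)

Section GlobalPowerSeries.
Variable R : realType.
Implicit Types (f : R[i] -> R[i]) (a b : nat -> R[i]) (z v : R[i]).

Definition expands f z a (r : R) := forall v, normc v < r ->
  ccvg (series (fun n => a n * v ^+ n)) (f (z + v)).

Lemma analyticP f : analytic f <->
  forall z, normc z < 1 -> exists r a, 0 < r /\ expands f z a r.
Proof.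
split => [hf z /hf[r [a [r0 h]]]|hf z /hf[r [a [r0 h]]]]; exists r, a; split => //.
- move=> v vr; have := h (z + v); rewrite addrAC subrr add0r => /(_ vr).
  by move=> /ccvgP.
- move=> w wr; apply/ccvgP; have := h (w - z) wr.
  by rewrite [z + _]addrC subrK.
Qed.

Lemma geo_bounded_leM a (s s' M M' : R) : geo_bounded a s M -> 0 <= s' <= s -> M <= M' ->
  geo_bounded a s' M'.
Proof.
move=> h /andP[s'0 s's] MM' n; apply: le_trans (le_trans (h n) MM').
by rewrite ler_wpM2l ?normc_ge0// lerXn2r ?nnegrE// (le_trans s'0).
Qed.

Lemma expands_bounded f z a r s : expands f z a r -> 0 <= s -> s < r ->
  exists M, geo_bounded a s M.
Proof.
move=> h s0 sr; have ns : normc (s%:C) = s by rewrite normc_real ger0_norm.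
have [|M hM] := @pseries_bounded _ a s%:C (f (z + s%:C)).
  by apply: h; rewrite ns.
by exists M => n; have := hM n; rewrite ns.
Qed.

Lemma expands_reexp f z a r u b s : expands f z a r -> normc u < r ->
  0 < s -> expands f (z + u) b s -> b = reexp a u.
Proof.
move=> ha ur s0 hb; pose t := (r - normc u) / 2.
have t0 : 0 < t by rewrite divr_gt0// subr_gt0.
have ut0 : 0 <= normc u + t by rewrite addr_ge0 ?normc_ge0// ltW.
have [|M hM] := expands_bounded ha ut0; first by rewrite /t; lra.
apply: (@pseries_unique _ _ _ (Num.min s t) (fun v => f (z + u + v))).
- by rewrite lt_min s0.
- by move=> v; rewrite lt_min => /andP[vs _]; exact: hb.
- move=> v; rewrite lt_min => /andP[_ vt].
  apply: (reexp_sum hM); first by rewrite ltrD2l.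
  rewrite -addrA; apply: ha; apply: le_lt_trans (le_normcD _ _) _.
  by move: vt; rewrite /t; lra.
Qed.

Lemma expands_shift f z a r u M s : geo_bounded a s M -> expands f z a r ->
  s < r -> 0 < s -> normc u < s / 4 ->
  geo_bounded (reexp a u) (s / 4) (2 * M) /\ expands f (z + u) (reexp a u) (s / 4).
Proof.
move=> hM ha sr s0 us; have M0 : 0 <= M.
  by apply: le_trans (hM 0%N); rewrite mulr_ge0 ?normc_ge0 ?exprn_ge0// ltW.
split.
  have h1 : normc u + s / 4 < s by lra.
  have s4 : 0 <= s / 4 by lra.
  apply: (geo_bounded_leM (reexp_bounded hM s4 h1)); first by rewrite lexx s4.
  rewrite ler_pdivrMr; last by rewrite subr_gt0 ltr_pdivrMr ?mul1r.
  have : (normc u + s / 4) / s <= 1 / 2 by rewrite ler_pdivrMr//; lra.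
  by nra.
move=> v vs; apply: (reexp_sum hM); first by lra.
by rewrite -addrA; apply: ha; apply: le_lt_trans (le_normcD _ _) _; lra.
Qed.

(** A local expansion at z yields expansions at all nearby points, with a
    fixed fraction of the radius and twice the bound, so that compactness applies. The
    compact set is a square containing the disc; its points of modulus at
    least 1 have a neighbourhood that avoids |z| <= rho. *)
Lemma analytic_uniform f (rho : R) : analytic f -> rho < 1 ->
  exists s M, 0 < s /\ forall z, normc z <= rho ->
    exists b, geo_bounded b s M /\ expands f z b s.
Proof.
move=> /analyticP hf rho1.
pose pl (x : R * R) : R[i] := x.1 +i* x.2.
pose P (n : nat) (x : R * R) := normc (pl x) <= rho ->
  exists b, geo_bounded b (n.+1%:R^-1) n%:R /\ expands f (pl x) b (n.+1%:R^-1).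
pose K : set (R * R) := `[-1, 1]%classic `*` `[-1, 1]%classic.
have cK : compact K by apply: compact_setX; exact: segment_compact.
have nb (x : R * R) (e : R) : 0 < e -> nbhs x [set y | normc (pl y - pl x) < e].
  move=> e0; apply/nbhs_ballP; exists (e / 2); first by rewrite /= divr_gt0.
  move=> y [/=]; rewrite -!ball_normE /= => h1 h2.
  change (normc (pl y - pl x) < e). apply: (le_lt_trans (normc_le_ReIm _)); rewrite cReB cImB /=.
  by rewrite -(distrC x.1) -(distrC x.2); lra.
have : \forall n \near \oo, K `<=` P n.
  apply: (iffLR (compact_near_coveringP K) cK nat \oo P) => x _.
  have [x1|x1] := ltP (normc (pl x)) 1; last first.
    exists ([set y | normc (pl y - pl x) < 1 - rho], setT).
      by split; [apply: nb; rewrite subr_gt0|exact: filterT].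
    move=> [y n] [hy _] hyr; exfalso.
    have hy' : normc (pl y - pl x) < 1 - rho by [].
    have hyr' : normc (pl y) <= rho by [].
    have : normc (pl x) <= normc (pl y) + normc (pl y - pl x).
      by rewrite normc_distC -{1}(subrK (pl y) (pl x)) addrC le_normcD.
    by move=> ?; lra.
  have [r [a [r0 ha]]] := hf _ x1.
  pose s := r / 2; have s0 : 0 < s by rewrite divr_gt0.
  have sr : s < r by rewrite /s; lra.
  have [M hM] := expands_bounded ha (ltW s0) sr.
  exists ([set y | normc (pl y - pl x) < s / 4],
      [set n | n.+1%:R^-1 < s / 4 /\ 2 * M <= n%:R]).
    split; first by apply: nb; rewrite divr_gt0.
    have s40 : 0 < s / 4 by rewrite divr_gt0.
    apply: filterI; first exact: (near_infty_natSinv_lt (PosNum s40)).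
    exact: nbhs_infty_ger.
  move=> [y n] [hy0 [hn1 hn2]] _.
  have hy : normc (pl y - pl x) < s / 4 := hy0.
  have [h1 h2] := expands_shift hM ha sr s0 hy.
  exists (reexp a (pl y - pl x)); split.
    by apply: (geo_bounded_leM h1) => //; rewrite invr_ge0 ler0n ltW.
  by move=> v vn; have := h2 v (lt_trans vn hn1); rewrite [pl x + _]addrC subrK.
move=> [n _ /(_ n (leqnn _)) hn]; exists n.+1%:R^-1, n%:R; split; first by rewrite invr_gt0.
move=> z zr; have plz : pl (complex.Re z, complex.Im z) = z by case: z {zr}.
rewrite -{1}plz in zr; rewrite -plz; apply: hn => //; rewrite plz in zr.
have z1 : normc z < 1 by exact: le_lt_trans zr rho1.
split; rewrite /= in_itv /= -ler_norml ltW//.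
- exact: le_lt_trans (Re_le_normc z) z1.
- exact: le_lt_trans (Im_le_normc z) z1.
Qed.

(** The hypothesis bounds the power series sum_k C(k+j,j) a_(k+j) z^k on
    |z| < r. By [coef_estimate] its coefficients satisfy
    C(n,j) |a_n| r^(n-j) (2y)^j <= 2 (n+1) B, and summing these bounds against
    2^(-j) reconstructs (r + y)^n by the binomial formula. *)
Lemma reexp_coef_bound a (s M r B y : R) : geo_bounded a s M -> 0 < r -> r < s ->
  (forall z j, normc z < r -> normc (reexp a z j) * (y + y) ^+ j <= B) -> 0 < y ->
  forall n, normc (a n) * (r + y) ^+ n <= 4 * B * n.+1%:R.
Proof.
move=> ha r0 rs hB y0 n.
have s0 : 0 < s by lra.
have B0 : 0 <= B.
  have := hB 0 0%N; rewrite normc0 => /(_ r0); apply: le_trans.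
  by rewrite mulr_ge0 ?normc_ge0 ?exprn_ge0//; lra.
have key j : (j <= n)%N ->
    'C(n, j)%:R * normc (a n) * r ^+ (n - j) * (y + y) ^+ j <= n.+1%:R * (2 * B).
  move=> jn; pose a' k := 'C(k + j, j)%:R * a (k + j)%N.
  have yj : 0 < (y + y) ^+ j by rewrite exprn_gt0; lra.
  have x0 : r < (r + s) / 2 by lra.
  have ha' : geo_bounded a' ((r + s) / 2) (M / ((s - r) / 2) ^+ j).
    have sr2 : 0 < (s - r) / 2 by lra.
    move=> k; rewrite ler_pdivlMr ?exprn_gt0//.
    have xn : normc (((r + s) / 2)%:C : R[i]) = (r + s) / 2.
      by rewrite normc_real ger0_norm//; lra.
    have := @reexp_term_le _ a s M (((r + s) / 2)%:C) ((s - r) / 2) j (k + j) ha s0.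
    rewrite /reexp_term addnK normcM normcX xn -/(a' k).
    have -> : ((r + s) / 2 + (s - r) / 2) / s = 1.
      by field; rewrite gt_eqF.
    by rewrite expr1n mulr1; apply; lra.
  have csumE z : normc z < r -> csum (fun k => a' k * z ^+ k) = reexp a z j.
    move=> zr; have cv := @reexp_cvg _ a s M z j ha (lt_trans zr rs).
    apply: csumE; have := ccvg_shift j cv; apply: eq_ccvg => N.
    rewrite /series /= addnC (big_cat_nat _ (n := j))//= ?leq_addr//.
    rewrite big_nat big1 ?add0r; last first.
      by move=> m /andP[_ mj]; rewrite /reexp_term bin_small// !mul0r.
    rewrite -{1}[j]add0n big_addn addnC addnK.
    by apply: eq_bigr => i _; rewrite /reexp_term addnK.
  have h : forall z, normc z < r -> normc (csum (fun k => a' k * z ^+ k)) <= B / (y + y) ^+ j.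
    by move=> z zr; rewrite csumE// ler_pdivlMr//; exact: hB.
  have := coef_estimate (n - j) ha' r0 x0 h.
  rewrite /a' subnK// normcM normc_nat !mulrA ler_pdivlMr// => /le_trans; apply.
  rewrite -!mulrA ler_wpM2r ?mulr_ge0// ler_nat ltnS leq_subr//.
rewrite exprDn mulr_sumr.
apply: le_trans (_ : \sum_(i < n.+1) (n.+1%:R * (2 * B)) * (1 / 2) ^+ i <= _).
  apply: ler_sum => i _; rewrite -mulr_natr.
  have jn : (i <= n)%N by rewrite -ltnS.
  have h2 : 0 <= (1 / 2 : R) ^+ i by rewrite exprn_ge0//; lra.
  apply: le_trans (ler_wpM2r h2 (key _ jn)).
  have yE : y = (y + y) * (1 / 2) by field.
  rewrite {1}yE exprMn le_eqVlt; apply/orP; left; apply/eqP; ring.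
have C0 : 0 <= n.+1%:R * (2 * B) by rewrite !mulr_ge0.
have := @sum_geo_le R (n.+1%:R * (2 * B)) (1 / 2) 0 n.+1 C0 ltac:(lra) ltac:(lra).
rewrite big_mkord => /le_trans; apply.
by rewrite expr0 mulr1 le_eqVlt; apply/orP; left; apply/eqP; field.
Qed.

Lemma poly_geo_bounded a (t s C : R) : 0 < s -> s < t ->
  (forall n, normc (a n) * t ^+ n <= C * n.+1%:R) -> exists M, geo_bounded a s M.
Proof.
move=> s0 st h; have t0 : 0 < t by lra.
have C0 : 0 <= C.
  by have := h 0%N; rewrite expr0 !mulr1; apply: le_trans; exact: normc_ge0.
pose q := s / t; have q0 : 0 <= q by rewrite divr_ge0// ltW.
have q1 : q < 1 by rewrite ltr_pdivrMr// mul1r.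
exists (C * (1 + (1 - q)^-1)) => n.
have -> : s = t * q by rewrite /q mulrC divfK// gt_eqF.
rewrite exprMn mulrA; apply: le_trans (_ : C * n.+1%:R * q ^+ n <= _).
  by rewrite ler_wpM2r// exprn_ge0.
rewrite -mulrA ler_wpM2l// -natr1 mulrDl mul1r addrC lerD//.
  by rewrite exprn_ile1// ltW.
exact: natr_geo_le.
Qed.

(** The local expansions at the points of |z| < rho have radius at least s and
    a common bound, by [analytic_uniform]; their coefficients are the [reexp a z],
    so [reexp_coef_bound] applies and the series at 0 converges beyond rho. A
    point beyond rho is then reached from a point of the disc |z| < rho on the
    same ray. *)
Lemma expands_extend f a (rho : R) : analytic f -> 0 < rho -> rho < 1 ->
  expands f 0 a rho -> exists2 e, 0 < e & expands f 0 a (rho + e).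
Proof.
move=> hf rho0 rho1 ha.
have [s' [M [s'0 hs']]] := analytic_uniform hf rho1.
pose s := Num.min s' rho.
have s0 : 0 < s by rewrite lt_min s'0.
have srho : s <= rho by rewrite ge_min lexx orbT.
have hs z : normc z <= rho -> exists b, geo_bounded b s M /\ expands f z b s.
  move=> /hs'[b [h1 h2]]; exists b; split.
    by apply: (geo_bounded_leM h1) => //; rewrite ltW//= ge_min lexx.
  by move=> v; rewrite lt_min => /andP[vs _]; exact: h2.
have reE z b : normc z < rho -> expands f z b s -> b = reexp a z.
  by move=> zr hb; apply: (expands_reexp ha zr s0); rewrite add0r.
(* r < rho, where the coefficients are controlled, but r + y > rho. *)
pose y := s / 2; pose r := rho - s / 4.
have r0 : 0 < r by rewrite /r; lra.
have y0 : 0 < y by rewrite /y; lra.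
have A0 : 0 <= rho - s / 8 by lra.
have [|A hA] := expands_bounded ha A0; first by lra.
have bound : forall z j, normc z < r -> normc (reexp a z j) * (y + y) ^+ j <= M.
  move=> z j zr; have zrho : normc z < rho by move: zr; rewrite /r; lra.
  have [b [hb1 hb2]] := hs z (ltW zrho).
  rewrite -(reE z b zrho hb2).
  have -> : y + y = s by rewrite /y; lra.
  exact: hb1.
have rA : r < rho - s / 8 by rewrite /r; lra.
have an := reexp_coef_bound hA r0 rA bound y0.
have [|||M' hM'] := @poly_geo_bounded a (r + y) (rho + s / 8) (4 * M); try by rewrite /r /y; lra.
  exact: an.
exists (s / 8); first by lra.
move=> z zs; rewrite add0r.
have [zrho|zrho] := ltP (normc z) rho; first by have := ha z zrho; rewrite add0r.
have z0 : 0 < normc z by lra.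
(* The point z c lies at distance s/4 from z, on the segment from 0 to z. *)
pose c := 1 - s / 4 / normc z.
have c0 : 0 <= c by rewrite subr_ge0 ler_pdivrMr// mul1r; lra.
have nzc : normc (z * c%:C) = normc z - s / 4.
  by rewrite normcM normc_real ger0_norm// /c mulrBr mulr1 mulrC divfK// gt_eqF.
have vE : z - z * c%:C = z * (s / 4 / normc z)%:C.
  by rewrite /c rmorphB /= mulrBr mulr1 opprB addrCA subrr addr0.
have nv : normc (z - z * c%:C) = s / 4.
  rewrite vE normcM normc_real ger0_norm ?divr_ge0 ?normc_ge0//; last lra.
  by rewrite mulrC divfK// gt_eqF.
have zcrho : normc (z * c%:C) < rho by rewrite nzc; lra.
have [b [hb1 hb2]] := hs _ (ltW zcrho).
have cv1 := hb2 (z - z * c%:C).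
rewrite nv [z * _ + _]addrC subrK (reE _ _ zcrho hb2) in cv1.
have cv := ccvg_pseries hM' zs.
have cv2 : ccvg (series (fun j => reexp a (z * c%:C) j * (z - z * c%:C) ^+ j))
    (csum (fun n => a n * z ^+ n)).
  apply: (reexp_sum hM'); first by rewrite nzc nv; lra.
  by rewrite [z * _ + _]addrC subrK.
by rewrite (ccvg_unique (cv1 ltac:(lra)) cv2).
Qed.

(** The supremum of the radii on which the series at 0 represents f is 1,
    since [expands_extend] would otherwise exceed it. *)
Lemma analytic_pseries f : analytic f -> exists a, expands f 0 a 1.
Proof.
move=> hf; have [|r [a [r0 ha]]] := (iffLR (analyticP f) hf) 0; first by rewrite normc0.
exists a; pose E := [set rho | 0 < rho <= 1 /\ expands f 0 a rho].
have E0 : E (Num.min r 1).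
  split; first by rewrite lt_min r0 ltr01 ge_min lexx orbT.
  by move=> v; rewrite lt_min => /andP[vr _]; exact: ha.
have hE : has_sup E.
  by split; [exists (Num.min r 1)|exists 1 => x [/andP[]]].
have S1 : sup E <= 1 by apply: ge_sup; [exists (Num.min r 1)|move=> x [/andP[]]].
have S0 : 0 < sup E.
  by apply: lt_le_trans (ub_le_sup hE.2 E0); rewrite lt_min r0 ltr01.
have hS : expands f 0 a (sup E).
  move=> v vS; have [rho [_ h] vrho] := sup_gt hE.1 vS.
  exact: h.
move: S1; rewrite le_eqVlt => /predU1P[<-//|S1].
have [e e0 he] := expands_extend hf S0 S1 hS.
have : E (Num.min (sup E + e) 1).
  split; first by rewrite lt_min ltr01 addr_gt0// ge_min lexx orbT.
  by move=> v; rewrite lt_min => /andP[vr _]; exact: he.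
move=> /(ub_le_sup hE.2); rewrite ge_min => /orP[h|h]; exfalso; lra.
Qed.

Lemma pseries_analytic f a : expands f 0 a 1 -> analytic f.
Proof.
move=> ha; apply/analyticP => z z1.
pose s := (1 + normc z) / 2; have nz0 := normc_ge0 z.
have s0 : 0 <= s by rewrite /s; lra.
have [|M hM] := expands_bounded ha s0; first by rewrite /s; lra.
exists (s - normc z), (reexp a z); split; first by rewrite /s; lra.
move=> v vs; apply: (reexp_sum hM); first by lra.
have := ha (z + v); rewrite add0r; apply; apply: le_lt_trans (le_normcD _ _) _.
by move: vs; rewrite /s; lra.
Qed.

End GlobalPowerSeries.

(** * The spaces L^p and A^p *)

Section Bergman.
Variable R : realType.
Local Notation mD := (@measurable_pdisc R).
Local Notation dint := (cint (sigma R) (@pdisc R)).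
Local Notation dintegrable := (cintegrable (sigma R) (@pdisc R)).
Local Notation dmeas := (cmeas (@pdisc R)).
Implicit Types (p q : R) (f h : R[i] -> R[i]) (g : R2 R -> R[i]) (z w : R[i]).

Lemma powRD_le (x y p : R) : 0 <= x -> 0 <= y -> 0 <= p ->
  (x + y) `^ p <= 2 `^ p * (x `^ p + y `^ p).
Proof.
move=> x0 y0 p0.
have aux (u v : R) : 0 <= u -> u <= v -> (u + v) `^ p <= 2 `^ p * (u `^ p + v `^ p).
  move=> u0 uv; have v0 := le_trans u0 uv.
  apply: le_trans (_ : (2 * v) `^ p <= _).
    by apply: ge0_ler_powR; rewrite ?nnegrE ?addr_ge0 ?mulr_ge0//; lra.
  by rewrite powRM// ler_wpM2l ?powR_ge0// lerDr powR_ge0.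
have [xy|/ltW yx] := leP x y; first exact: aux.
by rewrite [x + y]addrC [_ + y `^ p]addrC; exact: aux.
Qed.

Definition Lp p g := dmeas g /\
  (sigma R).-integrable (@pdisc R) (EFin \o (fun x => normc (g x) `^ p)).

Lemma LpD p g1 g2 : 0 <= p -> Lp p g1 -> Lp p g2 -> Lp p (fun x => g1 x + g2 x).
Proof.
move=> p0 [m1 i1] [m2 i2]; have mg := cmeasD m1 m2; split => //.
apply: (le_integrable_real mD (w' := fun x => 2 `^ p * (normc (g1 x) `^ p + normc (g2 x) `^ p))).
- exact: measurable_normc_powR.
- move=> x _; rewrite ger0_norm ?powR_ge0//.
  apply: le_trans (powRD_le (normc_ge0 _) (normc_ge0 _) p0).
  by apply: ge0_ler_powR; rewrite ?nnegrE ?addr_ge0 ?normc_ge0 ?le_normcD.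
- exact: (integrableZl mD (2 `^ p) (integrableD mD i1 i2)).
Qed.

Lemma LpZ p g c : Lp p g -> Lp p (fun x => c * g x).
Proof.
move=> [m i]; have mg := cmeasM (cmeas_cst _ c) m; split => //.
have := integrableZl mD (normc c `^ p) i; apply: eq_integrable; first exact: mD.
by move=> x _ /=; rewrite -EFinM normcM powRM ?normc_ge0.
Qed.

Lemma Lp_conj p g : Lp p g -> Lp p (fun x => (g x)^*).
Proof.
move=> [m i]; split; first exact: cmeas_conj.
by under eq_fun do rewrite normc_conj.
Qed.

Lemma Lp0 p : p != 0 -> Lp p (fun=> 0).
Proof.
move=> p0; split; first exact: cmeas_cst.
under eq_fun do rewrite normc0 powR0//.
exact: (integrable_cst_pdisc 0).
Qed.

Lemma Lp_sum p N (c : 'I_N -> R[i]) (G : 'I_N -> R2 R -> R[i]) : 0 < p ->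
  (forall i, Lp p (G i)) -> Lp p (fun x => \sum_(i < N) c i * G i x).
Proof.
move=> p0 hG; elim: (index_enum _) => [|i r IH].
  by under eq_fun do rewrite big_nil; apply: Lp0; rewrite gt_eqF.
under eq_fun do rewrite big_cons.
by apply: LpD; [exact: ltW|exact: LpZ|].
Qed.

Lemma Lp_bounded p g (B : R) : 0 <= p -> dmeas g ->
  (forall x, pdisc x -> normc (g x) <= B) -> Lp p g.
Proof.
move=> p0 mg gB; split => //.
apply: (le_integrable_real mD (w' := cst (B `^ p))).
- exact: measurable_normc_powR.
- move=> x Dx; rewrite ger0_norm ?powR_ge0//.
  have B0 : 0 <= B := le_trans (normc_ge0 _) (gB x Dx).
  by apply: ge0_ler_powR; rewrite ?nnegrE ?normc_ge0 ?gB.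
- exact: integrable_cst_pdisc.
Qed.

Definition conjugate p q := [/\ 0 < p, 0 < q & p^-1 + q^-1 = 1].

Lemma young_normc p q (a b : R[i]) : conjugate p q ->
  normc (a * b) <= normc a `^ p / p + normc b `^ q / q.
Proof.
by move=> [p0 q0 pq]; rewrite normcM; apply: conjugate_powR; rewrite ?normc_ge0.
Qed.

Lemma integrable_young p q g1 g2 : Lp p g1 -> Lp q g2 ->
  (sigma R).-integrable (@pdisc R)
    (EFin \o (fun x => normc (g1 x) `^ p / p + normc (g2 x) `^ q / q)).
Proof.
move=> [_ i1] [_ i2].
have := integrableD mD (integrableZl mD p^-1 i1) (integrableZl mD q^-1 i2).
by apply: eq_integrable => [|x _ /=]; [exact: mD|rewrite -!EFinM -EFinD mulrC [q^-1 * _]mulrC].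
Qed.

Lemma Lp_mul p q g1 g2 : conjugate p q -> Lp p g1 -> Lp q g2 ->
  dintegrable (fun x => g1 x * g2 x).
Proof.
move=> pq L1 L2; have iy := integrable_young L1 L2.
apply: (cintegrable_le mD _ _ iy).
  by apply: cmeasM; [case: L1|case: L2].
by move=> x _; exact: young_normc.
Qed.

Lemma expands_cmeas f a : expands f 0 a 1 -> dmeas (fun x => f (plane x)).
Proof.
move=> ha; apply: (@cmeas_cvg _ _ _ _ (fun N x => series (fun n => a n * plane x ^+ n) N)).
  move=> N; apply: cmeas_sum => n; apply: cmeasM; first exact: cmeas_cst.
  apply: cmeasX; exact: cmeas_plane.
by move=> x /pdiscP x1; have := ha _ x1; rewrite add0r.
Qed.

Lemma bergmanP p f : 0 < p ->
  bergman p f <-> analytic f /\ Lp p (fun x => f (plane x)).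
Proof.
move=> p0; split => [[af nf]|[af [mf /integrableP[_ jf]]]]; split => //.
  have [a ha] := analytic_pseries af; have mf := expands_cmeas ha.
  split => //; apply/integrableP; split.
    by apply/measurable_EFinP; exact: measurable_normc_powR.
  move: nf; rewrite /bergman_norm => /lty_poweRy; rewrite invr_eq0 gt_eqF// => /(_ erefl).
  apply: le_lt_trans; rewrite le_eqVlt; apply/orP; left; apply/eqP.
  by apply: eq_integral => x _ /=; rewrite ger0_norm ?powR_ge0.
rewrite /bergman_norm; apply: poweR_lty; apply: le_lt_trans jf.
rewrite le_eqVlt; apply/orP; left; apply/eqP.
by apply: eq_integral => x _ /=; rewrite ger0_norm ?powR_ge0.
Qed.

Lemma analytic_lincomb a f h : analytic f -> analytic h ->
  analytic (fun z => a * f z + h z).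
Proof.
move=> /analyticP hf /analyticP hh; apply/analyticP => z z1.
have [r1 [a1 [r10 h1]]] := hf z z1; have [r2 [a2 [r20 h2]]] := hh z z1.
exists (Num.min r1 r2), (fun n => a * a1 n + a2 n); split; first by rewrite lt_min r10.
move=> v; rewrite lt_min => /andP[v1 v2].
have := ccvgD (ccvgZ a (h1 v v1)) (h2 v v2); apply: eq_ccvg => N.
rewrite /series /= mulr_sumr -big_split /=; apply: eq_bigr => n _.
by rewrite mulrDl mulrA.
Qed.

Lemma bergman_lincomb p a f h : 0 < p -> bergman p f -> bergman p h ->
  bergman p (fun z => a * f z + h z).
Proof.
move=> p0 /(bergmanP _ p0)[af lf] /(bergmanP _ p0)[ah lh].
apply/(bergmanP _ p0); split; first exact: analytic_lincomb.
by apply: LpD; [exact: ltW|exact: LpZ|].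
Qed.

(** An expansion at z is Lipschitz at its centre. *)
Lemma analytic_ccvg f z (u : nat -> R[i]) : analytic f -> normc z < 1 ->
  ccvg u z -> ccvg (fun n => f (u n)) (f z).
Proof.
move=> /analyticP hf z1 uz; have [r [a [r0 ha]]] := hf z z1.
pose s := r / 2; have s0 : 0 < s by rewrite divr_gt0.
have sr : s < r by rewrite /s; lra.
have [M hM] := expands_bounded ha (ltW s0) sr.
have bnd v : normc v < s -> forall n, normc (a n * v ^+ n) <= M * (normc v / s) ^+ n.
  move=> vs n; rewrite normcM normcX; apply: geo_bounded_le => //; exact: normc_ge0.
have M0 : 0 <= M.
  by apply: le_trans (hM 0%N); rewrite mulr_ge0 ?normc_ge0 ?exprn_ge0// ltW.
have a0 : a 0%N = f z.
  have h0 : normc (0 : R[i]) < r by rewrite normc0.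
  have := ha 0 h0; rewrite addr0 => cv; apply/esym/(ccvg_unique cv).
  apply: (@eq_ccvg _ (fun n => if n == 0%N then 0 else a 0%N)).
    move=> [|n]; first by rewrite /series /= big_geq.
    rewrite /series /= big_nat_recl//= expr0 mulr1 big1 ?addr0// => i _.
    by rewrite expr0n mulr0.
  rewrite /ccvg; apply: cvg_near_cst; exists 1%N => // n /= n1.
  by rewrite gtn_eqF// subrr normc0.
have lip v : normc v < s / 2 -> normc (f (z + v) - f z) <= 2 * M / s * normc v.
  move=> vs; have vr : normc v < r by rewrite (lt_trans vs)// /s; lra.
  have t0 : 0 <= normc v / s by rewrite divr_ge0 ?normc_ge0// ltW.
  have t1 : normc v / s < 1 / 2 by rewrite ltr_pdivrMr//; lra.
  have t11 : normc v / s < 1 by lra.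
  have vs' : normc v < s by lra.
  have := series_geo_tail 1 t0 t11 (bnd v vs') (ha v vr).
  rewrite /series /= big_nat1 expr0 mulr1 expr1 a0 => /le_trans; apply.
  rewrite ler_pdivrMr; last lra.
  have E : 2 * M / s * normc v = 2 * M * (normc v / s) by rewrite mulrAC mulrA.
  rewrite E; set t := normc v / s in t0 t1 *.
  have t2 : 0 <= 1 - 2 * t by rewrite subr_ge0 mulrC -ler_pdivlMr// ltW.
  have := mulr_ge0 (mulr_ge0 M0 t0) t2; rewrite /=; lra.
rewrite /ccvg; apply: (@squeeze_cvgr _ _ _ _ (cst 0) (fun n => 2 * M / s * normc (u n - z))).
- have s20 : 0 < s / 2 by lra.
  move/cvgrPdist_lt : (uz) => /(_ _ s20); apply: filterS => n.
  rewrite sub0r normrN ger0_norm ?normc_ge0// => un.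
  rewrite /=.
  by have := lip _ un; rewrite [z + _]addrC subrK.
- exact: cvg_cst.
- by rewrite -(mulr0 (2 * M / s)); apply: cvgM => //; exact: cvg_cst.
Qed.

Lemma expands_dilation f a (r : R) : expands f 0 a 1 -> 0 < r -> r <= 1 ->
  expands (fun z => f (r%:C * z)) 0 (fun n => a n * r%:C ^+ n) 1.
Proof.
move=> ha r0 r1 v v1; rewrite add0r -[X in f X]add0r.
have : normc (r%:C * v) < 1.
  rewrite normcM normc_real gtr0_norm//; apply: le_lt_trans v1.
  by rewrite ler_piMl ?normc_ge0.
move=> /ha; apply: eq_ccvg => N; rewrite /series /=; apply: eq_bigr => n _.
by rewrite exprMn mulrA.
Qed.

(** Change of variables w' = r w, which maps the disc onto a subdisc. *)
Lemma Lp_dilation p f (r : R) : analytic f -> Lp p (fun x => f (plane x)) ->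
  0 < r -> r <= 1 -> Lp p (fun x => f (r%:C * plane x)) /\
  \int[sigma R]_(x in @pdisc R) (normc (f (r%:C * plane x)) `^ p) <=
  r ^- 2 * \int[sigma R]_(x in @pdisc R) (normc (f (plane x)) `^ p).
Proof.
move=> af [mf jf] r0 r1; have [a ha] := analytic_pseries af.
have mr : dmeas (fun x => f (r%:C * plane x)) := expands_cmeas (expands_dilation ha r0 r1).
have k0 : 0 <= r ^- 2 by rewrite invr_ge0 exprn_ge0// ltW.
pose F (x : R2 R) := (normc (f (plane x)) `^ p)%:E.
have mF : measurable_fun (@pdisc R) F by apply/measurable_EFinP; exact: measurable_normc_powR.
have F0 x : (0 <= F x)%E by rewrite lee_fin powR_ge0.
have sub := subdisc_pdisc r1.
have mFr : measurable_fun (subdisc r) F by apply: measurable_funS mF => //; exact: mD.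
have H := ge0_integral_scales (scales_area_dilation r0) k0 (measurable_subdisc r) mFr (fun x _ => F0 x).
rewrite dilation_preimage_subdisc// in H.
have FE x : F (cmulT r%:C x) = (normc (f (r%:C * plane x)) `^ p)%:E.
  by rewrite /F plane_cmulT.
rewrite (eq_integral (fun x => (normc (f (r%:C * plane x)) `^ p)%:E)) in H; last first.
  by move=> x _; exact: FE.
have jF : (sigma R).-integrable (@pdisc R) F := jf.
have fin : (\int[sigma R]_(x in @pdisc R) F x)%E \is a fin_num by apply: integrable_fin_num jF; exact: mD.
have le1 : (\int[sigma R]_(x in subdisc r) F x <= \int[sigma R]_(x in @pdisc R) F x)%E.
  by apply: ge0_subset_integral => //; [exact: measurable_subdisc|exact: mD].
have le2 : (\int[sigma R]_(x in @pdisc R) (normc (f (r%:C * plane x)) `^ p)%:E <=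
    (r ^- 2)%:E * \int[sigma R]_(x in @pdisc R) F x)%E.
  by rewrite H lee_wpmul2l// lee_fin.
have lt2 : (\int[sigma R]_(x in @pdisc R) (normc (f (r%:C * plane x)) `^ p)%:E < +oo)%E.
  apply: le_lt_trans le2 _; rewrite -(fineK fin) -EFinM; exact: ltry.
split.
  split => //; apply/integrableP; split.
    by apply/measurable_EFinP; exact: measurable_normc_powR.
  apply: le_lt_trans lt2; rewrite le_eqVlt; apply/orP; left; apply/eqP.
  by apply: eq_integral => x _ /=; rewrite ger0_norm ?powR_ge0.
rewrite -lee_fin EFinM /Rintegral fineK; last first.
  by rewrite ge0_fin_numE// integral_ge0// => x _; rewrite lee_fin powR_ge0.
by rewrite fineK.
Qed.

Lemma powR_cvg_gt0 p (u : nat -> R) (l : R) : 0 < l ->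
  u n @[n --> \oo] --> l -> (u n) `^ p @[n --> \oo] --> l `^ p.
Proof.
move=> lpos ul.
have posE x : 0 < x -> x `^ p = expR (p * ln x) by move=> x0; rewrite /powR gt_eqF.
rewrite posE//.
have : expR (p * ln (u n)) @[n --> \oo] --> expR (p * ln l).
  apply: continuous_cvg; first exact: continuous_expR.
  apply: cvgM; first exact: cvg_cst.
  by apply: continuous_cvg => //; exact: continuous_ln.
apply: cvg_trans; apply: near_eq_cvg.
have : \forall n \near \oo, 0 < u n by exact: (cvgr_gt _ ul).
by apply: filterS => n un; rewrite posE.
Qed.

Lemma powR_cvg_pos p (u : nat -> R) (l : R) : 0 < p -> (forall n, 0 <= u n) ->
  u n @[n --> \oo] --> l -> (u n) `^ p @[n --> \oo] --> l `^ p.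
Proof.
move=> p0 u0 ul.
have l0 : 0 <= l by apply: (cvgr_to_ge ul); exact: nearW.
have [lpos|] := ltP 0 l; last first.
  move=> ln; have le0 : l = 0 by apply/eqP; rewrite eq_le ln.
  rewrite le0 powR0 ?gt_eqF//; apply/cvgrPdist_lt => e e0.
  have e1 : 0 < e `^ p^-1 by rewrite powR_gt0.
  move/cvgrPdist_lt : ul => /(_ _ e1); apply: filterS => n.
  rewrite le0 !sub0r !normrN !ger0_norm ?powR_ge0// => un.
  have -> : e = (e `^ p^-1) `^ p by rewrite -powRrM mulVf ?gt_eqF// powRr1// ltW.
  by apply: gt0_ltr_powR; rewrite ?nnegrE ?powR_ge0.
exact: powR_cvg_gt0.
Qed.

(** Any sequence increasing to 1 would do; this one avoids 0. *)
Definition radius (n : nat) : R := 1 - n.+2%:R^-1.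

Lemma radius_gt0 n : 0 < radius n.
Proof. by rewrite subr_gt0 invf_lt1// ltr1n. Qed.

Lemma radius_lt1 n : radius n < 1.
Proof. by rewrite ltrBlDr ltrDl invr_gt0. Qed.

Lemma radius_cvg : radius n @[n --> \oo] --> (1 : R).
Proof.
rewrite -[X in _ --> X]subr0; apply: cvgB; first exact: cvg_cst.
have h := @cvg_harmonic R.
have := cvg_comp _ _ (cvg_addnr 1) h; apply: cvg_trans.
by rewrite (_ : _ \o _ = (fun n => n.+2%:R^-1))//; apply/funext => n /=; rewrite addn1.
Qed.

Lemma ccvg_radius z : ccvg (fun n => (radius n)%:C * z) z.
Proof.
apply: (@ccvg_squeeze _ _ _ (fun n => `|1 - radius n| * normc z)).
  move=> n; have -> : (radius n)%:C * z - z = (radius n - 1)%:C * z.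
    rewrite -[X in _ - X]mul1r -mulrBl; congr (_ * _).
    by apply: eqcP; rewrite ?cReB ?cImB /= ?subr0.
  by rewrite normcM normc_real distrC.
rewrite -(mul0r (normc z)); apply: cvgM; last exact: cvg_cst.
rewrite -(normr0 R) -(subrr (1 : R)); apply: cvg_norm.
by apply: cvgB; [exact: cvg_cst|exact: radius_cvg].
Qed.

(** Weak convergence of the dilates: the product is dominated, through Young's
    inequality, by functions whose integrals are controlled by [Lp_dilation]. *)
Lemma dint_dilation_cvg p q f g : conjugate p q -> bergman p f -> Lp q g ->
  ccvg (fun n => dint (fun x => f ((radius n)%:C * plane x) * g x))
    (dint (fun x => f (plane x) * g x)).
Proof.
move=> pq bf lg; have [p0 q0 pq1] := pq.
have [af lf] := iffLR (bergmanP f p0) bf.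
have dil n := Lp_dilation af lf (radius_gt0 n) (ltW (radius_lt1 n)).
pose I := \int[sigma R]_(x in @pdisc R) (normc (f (plane x)) `^ p).
pose J := \int[sigma R]_(x in @pdisc R) (normc (g x) `^ q).
have jIn n : (sigma R).-integrable (@pdisc R) (EFin \o (fun x => p^-1 * normc (f ((radius n)%:C * plane x)) `^ p)).
  exact: (integrableZl mD p^-1 (dil n).1.2).
have jI : (sigma R).-integrable (@pdisc R) (EFin \o (fun x => p^-1 * normc (f (plane x)) `^ p)).
  exact: (integrableZl mD p^-1 lf.2).
have jJ : (sigma R).-integrable (@pdisc R) (EFin \o (fun x => (2 / q) * normc (g x) `^ q)).
  exact: (integrableZl mD (2 / q) lg.2).
have jA n : (sigma R).-integrable (@pdisc R) (EFin \o (fun x =>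
    p^-1 * normc (f ((radius n)%:C * plane x)) `^ p + p^-1 * normc (f (plane x)) `^ p)).
  exact: (integrableD mD (jIn n) jI).
have jB : (sigma R).-integrable (@pdisc R) (EFin \o (fun x =>
    p^-1 * normc (f (plane x)) `^ p + p^-1 * normc (f (plane x)) `^ p)).
  exact: (integrableD mD jI jI).
apply: (@cint_cvg _ _ _ _ _ mD _ _
  (fun n x => p^-1 * normc (f ((radius n)%:C * plane x)) `^ p + p^-1 * normc (f (plane x)) `^ p
    + (2 / q) * normc (g x) `^ q)
  (fun x => p^-1 * normc (f (plane x)) `^ p + p^-1 * normc (f (plane x)) `^ p
    + (2 / q) * normc (g x) `^ q)
  (fun n => p^-1 * ((radius n) ^- 2 * I) + p^-1 * I + (2 / q) * J)).
- by move=> n; apply: cmeasM; [case: (dil n) => -[]|case: lg].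
- exact: Lp_mul pq lf lg.
- move=> x /pdiscP x1; rewrite [f _ * _]mulrC.
  have := ccvgZ (g x) (analytic_ccvg af x1 (ccvg_radius (plane x))).
  by apply: eq_ccvg => n; rewrite mulrC.
- move=> n x _; apply: le_trans (ler_normcB _ _) _.
  apply: le_trans (lerD (young_normc _ _ pq) (young_normc _ _ pq)) _.
  by rewrite le_eqVlt; apply/orP; left; apply/eqP; ring.
- move=> x /pdiscP x1; apply: cvgD; last exact: cvg_cst.
  apply: cvgD; last exact: cvg_cst.
  apply: cvgM; first exact: cvg_cst.
  have cv := ccvg_normc (analytic_ccvg af x1 (ccvg_radius (plane x))).
  by apply: powR_cvg_pos cv => // n; exact: normc_ge0.
- by move=> n; exact: (integrableD mD (jA n) jJ).
- exact: (integrableD mD jB jJ).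
- move=> n; rewrite RintegralD//; [|exact: mD].
  rewrite RintegralD//; [|exact: mD].
  rewrite !RintegralZl//; [|exact: mD|exact: lg.2|exact: mD|exact: lf.2|exact: mD|exact: (dil n).1.2].
  by rewrite !lerD2r ler_wpM2l ?invr_ge0 ?(ltW p0)//; exact: (dil n).2.
- rewrite RintegralD//; [|exact: mD].
  rewrite RintegralD//; [|exact: mD].
  rewrite !RintegralZl//; [|exact: mD|exact: lg.2|exact: mD|exact: lf.2].
  apply: cvgD; last exact: cvg_cst.
  apply: cvgD; last exact: cvg_cst.
  apply: cvgM; first exact: cvg_cst.
  rewrite -/I -[X in _ --> X]mul1r; apply: cvgM; last exact: cvg_cst.
  rewrite -[X in _ --> X]invr1; apply: cvgV; first by rewrite oner_eq0.
  have h := cvgM radius_cvg radius_cvg; rewrite mulr1 in h.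
  exact: h.
Qed.

End Bergman.

(** * The Bergman kernel *)

Section Kernel.
Variable R : realType.
Local Notation mD := (@measurable_pdisc R).
Local Notation dint := (cint (sigma R) (@pdisc R)).
Local Notation dintegrable := (cintegrable (sigma R) (@pdisc R)).
Local Notation dmeas := (cmeas (@pdisc R)).
Implicit Types (p q : R) (f h k : R[i] -> R[i]) (g : R2 R -> R[i]) (z w u : R[i]).

Lemma ccvg_arith_geometric u : normc u < 1 ->
  ccvg (series (fun n => n.+1%:R * u ^+ n)) ((1 - u) ^- 2).
Proof.
move=> u1; have u0 := normc_ge0 u.
have d0 : 1 - u != 0.
  by rewrite subr_eq0; apply/eqP => E; move: u1; rewrite -E normc1 ltxx.
have fin n : (1 - u) ^+ 2 * series (fun n => n.+1%:R * u ^+ n) n =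
    1 - n.+1%:R * u ^+ n + n%:R * u ^+ n.+1.
  elim: n => [|n IH]; first by rewrite /series /= big_geq// expr0; ring.
  rewrite /series /= big_nat_recr//= mulrDr [X in X + _]IH !exprS -!natr1; ring.
have cv : ccvg (fun n => (1 - u) ^+ 2 * series (fun n => n.+1%:R * u ^+ n) n) 1.
  apply: (@ccvg_squeeze _ _ _ (fun n => n%:R * (2 * normc u ^+ n) + 1 * normc u ^+ n)).
    move=> n; rewrite fin.
    have -> : 1 - n.+1%:R * u ^+ n + n%:R * u ^+ n.+1 - 1 =
        n%:R * u ^+ n.+1 - n.+1%:R * u ^+ n by ring.
    apply: le_trans (ler_normcB _ _) _; rewrite !normcM !normc_nat !normcX.
    have un : 0 <= normc u ^+ n by rewrite exprn_ge0.
    rewrite exprS -natr1 mul1r.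
    have h : normc u * normc u ^+ n <= normc u ^+ n by rewrite ler_piMl// ltW.
    have n0 : 0 <= n%:R :> R by [].
    have := ler_wpM2l n0 h; lra.
  rewrite -(addr0 0); apply: cvgD; first exact: cvg_natr_geo.
  by apply: cvg_geometric; rewrite ger0_norm.
have := ccvgZ ((1 - u) ^- 2) cv; rewrite mulr1; apply: eq_ccvg => n.
by rewrite mulrA mulVf ?mul1r// expf_neq0.
Qed.

(** The kernel is conj(z)-analytic in z and analytic in w, so that it belongs
    to A^p as a function of w. *)
Definition bker z w : R[i] := (1 - z^* * w) ^- 2.
Definition bker_coef z n : R[i] := n.+1%:R * z^* ^+ n.

Lemma bker_expands z : normc z < 1 -> expands (bker z) 0 (bker_coef z) 1.
Proof.
move=> z1 w w1; rewrite add0r /bker.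
have zw : normc (z^* * w) < 1.
  rewrite normcM normc_conj; apply: le_lt_trans w1.
  by rewrite ler_piMl ?normc_ge0// ltW.
apply: eq_ccvg (ccvg_arith_geometric zw) => N.
by rewrite /series /=; apply: eq_bigr => n _; rewrite /bker_coef exprMn mulrA.
Qed.

Lemma bker_coef_bounded z : normc z < 1 ->
  exists s M, 1 < s /\ geo_bounded (bker_coef z) s M.
Proof.
move=> z1; have z0 := normc_ge0 z.
pose s := 2 / (1 + normc z); have d0 : 0 < 1 + normc z by lra.
have s1 : 1 < s by rewrite ltr_pdivlMr//; lra.
pose t := normc z * s; have t0 : 0 <= t by rewrite mulr_ge0//; lra.
have t1 : t < 1 by rewrite /t /s mulrA ltr_pdivrMr//; lra.
exists s, ((1 - t)^-1 + 1); split => // n.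
rewrite /bker_coef normcM normc_nat normcX normc_conj -mulrA -exprMn -natr1 mulrDl mul1r.
by rewrite lerD ?natr_geo_le// exprn_ile1// ltW.
Qed.

Lemma bker_bounded z w : normc z < 1 -> normc w < 1 ->
  normc (bker z w) <= (1 - normc z) ^- 2.
Proof.
move=> z1 w1; have z0 := normc_ge0 z; have w0 := normc_ge0 w.
have h : 1 - normc z <= normc (1 - z^* * w).
  have : normc (1 : R[i]) <= normc (1 - z^* * w) + normc (z^* * w).
    by rewrite -{1}(subrK (z^* * w) 1) le_normcD.
  rewrite normc1 normcM normc_conj.
  have : normc z * normc w <= normc z by rewrite ler_piMr// ltW.
  lra.
rewrite /bker normcV normcX lef_pV2 ?posrE ?exprn_gt0//; try lra.
by rewrite lerXn2r ?nnegrE//; lra.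
Qed.

Lemma bergman_bker p z : 0 < p -> normc z < 1 -> bergman p (bker z).
Proof.
move=> p0 z1; have hz := bker_expands z1.
apply/(bergmanP _ p0); split; first exact: pseries_analytic hz.
apply: (@Lp_bounded _ _ _ ((1 - normc z) ^- 2)); first exact: ltW.
  exact: expands_cmeas hz.
by move=> x /pdiscP x1; exact: bker_bounded.
Qed.

Lemma bker_conj z w : (bker z w)^* = (1 - w^* * z) ^- 2.
Proof.
rewrite /bker conjc_inv conjcX; congr (_ ^- 2).
by rewrite rmorphB rmorph1 /= conjcM conjcK mulrC.
Qed.

Lemma bergman_projE f z : bergman_proj f z =
  dint (fun x => f (plane x) * (bker z (plane x))^*).
Proof. by rewrite /bergman_proj; apply: eq_cint => x _; rewrite bker_conj. Qed.

Lemma dint_expands f a (s M : R) g : expands f 0 a 1 -> geo_bounded a s M -> 1 < s ->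
  dintegrable g ->
  ccvg (series (fun n => a n * dint (fun x => plane x ^+ n * g x)))
    (dint (fun x => f (plane x) * g x)).
Proof.
move=> ha hM s1 jg; have [_ cv] := dint_pseries hM s1 jg.
rewrite (_ : dint _ = dint (fun x => csum (fun n => a n * plane x ^+ n) * g x))//.
apply: eq_cint => x /[!inE] /pdiscP x1; congr (_ * _); apply/esym/csumE.
by have := ha _ x1; rewrite add0r.
Qed.

(** Only the term of degree m of the kernel contributes, and its coefficient
    m + 1 cancels the square norm 1 / (m + 1) of the monomial. *)
Lemma dint_monom_bker z m : normc z < 1 ->
  dint (fun x => plane x ^+ m * (bker z (plane x))^*) = z ^+ m.
Proof.
move=> z1; have [s [M [s1 hM]]] := bker_coef_bounded z1.
have hz := bker_expands z1.
have E := dint_pseries_conj m hM s1.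
have jb : dintegrable (fun x => bker z (plane x) * (plane x)^* ^+ m).
  apply: (@dintegrable_bounded _ _ ((1 - normc z) ^- 2)).
    apply: cmeasM; first exact: expands_cmeas hz.
    by apply: cmeasX; apply: cmeas_conj; exact: cmeas_plane.
  move=> x /pdiscP x1; rewrite normcM normcX normc_conj.
  apply: le_trans (bker_bounded z1 x1); rewrite ler_piMr ?normc_ge0//.
  by rewrite exprn_ile1 ?normc_ge0// ltW.
transitivity ((dint (fun x => bker z (plane x) * (plane x)^* ^+ m))^*).
  rewrite -cint_conj; [|exact: mD|exact: jb].
  by apply: eq_cint => x _; rewrite conjcM conjcX conjcK mulrC.
rewrite (_ : dint _ = bker_coef z m / m.+1%:R).
  rewrite /bker_coef mulrAC divff ?pnatr_eq0// mul1r.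
  by rewrite conjcX conjcK.
rewrite -E; apply: eq_cint => x /[!inE] /pdiscP x1; congr (_ * _).
by apply/esym/csumE; have := hz _ x1; rewrite add0r.
Qed.

(** The dilated series converges on a disc of radius greater than 1, hence
    uniformly on the unit disc. *)
Lemma dilation_bounded f a (r : R) : expands f 0 a 1 -> 0 < r -> r < 1 ->
  exists s M, 1 < s /\ geo_bounded (fun n => a n * r%:C ^+ n) s M.
Proof.
move=> ha r0 r1; pose t := (1 + r) / 2.
have t0 : 0 <= t by rewrite /t; lra.
have [|M hM] := expands_bounded ha t0; first by rewrite /t; lra.
exists (t / r), M; split; first by rewrite ltr_pdivlMr// /t; lra.
move=> n; rewrite normcM normcX normc_real gtr0_norm// -mulrA -exprMn.
by rewrite [r * _]mulrC divfK ?gt_eqF.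
Qed.

Lemma Lp_bker_conj p z : 0 < p -> normc z < 1 -> Lp p (fun x => (bker z (plane x))^*).
Proof.
by move=> p0 z1; apply: Lp_conj; have [] := iffLR (bergmanP _ p0) (bergman_bker p0 z1).
Qed.

Lemma Lp_integrable q g : 1 < q -> Lp q g -> dintegrable g.
Proof.
move=> q1 lg; pose p := (1 - q^-1)^-1.
have q0 : 0 < q by lra.
have qi : q^-1 < 1 by rewrite invf_lt1.
have p0 : 0 < p by rewrite invr_gt0; lra.
have pq : conjugate p q by split => //; rewrite /p invrK; lra.
have l1 : Lp p (fun=> 1).
  by apply: (@Lp_bounded _ _ _ 1); [exact: ltW|exact: cmeas_cst|move=> x _; rewrite normc1].
have := Lp_mul pq l1 lg; apply: (eq_cintegrable mD) => x _.
by rewrite mul1r.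
Qed.

(** The formula is exact on monomials, hence on dilates, whose series converge
    uniformly; then r tends to 1 on both sides. *)
Lemma bergman_reproducing p q f z : conjugate p q -> bergman p f -> normc z < 1 ->
  dint (fun x => f (plane x) * (bker z (plane x))^*) = f z.
Proof.
move=> pq bf z1; have [p0 q0 _] := pq.
have [af _] := iffLR (bergmanP f p0) bf; have [a ha] := analytic_pseries af.
have lk := Lp_bker_conj q0 z1.
have jk : dintegrable (fun x => (bker z (plane x))^*).
  by apply: (@Lp_integrable 2); [lra|exact: Lp_bker_conj].
have cv1 := dint_dilation_cvg pq bf lk.
have cv2 := analytic_ccvg af z1 (ccvg_radius z).
apply: (ccvg_unique cv1); apply: eq_ccvg cv2 => n.
have r0 := radius_gt0 R n; have r1 := radius_lt1 R n.
have hr := expands_dilation ha r0 (ltW r1).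
have [s [M [s1 hM]]] := dilation_bounded ha r0 r1.
have cv3 := dint_expands hr hM s1 jk.
have cv4 := hr z z1; rewrite add0r in cv4.
apply: (ccvg_unique cv4); apply: eq_ccvg cv3 => N.
by rewrite /series /=; apply: eq_bigr => m _; rewrite dint_monom_bker.
Qed.

(** The integral of b_z g is the sum of a power series in conj(z), whose
    coefficients are n + 1 times the integrals of w^n g. *)
Lemma dint_monom_eq0 g : dintegrable g ->
  (forall z, normc z < 1 -> dint (fun x => bker z (plane x) * g x) = 0) ->
  forall n, dint (fun x => plane x ^+ n * g x) = 0.
Proof.
move=> jg h n.
have E : (fun n => n.+1%:R * dint (fun x => plane x ^+ n * g x)) = (fun=> 0).
  apply: (@pseries_unique _ _ _ 1 (fun=> 0)) => //.
    move=> v v1; have v1' : normc v^* < 1 by rewrite normc_conj.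
    have [s [M [s1 hM]]] := bker_coef_bounded v1'.
    have := dint_expands (bker_expands v1') hM s1 jg.
    rewrite h//; apply: eq_ccvg => N; rewrite /series /=; apply: eq_bigr => m _.
    by rewrite /bker_coef conjcK mulrAC.
  move=> v _; apply: (@eq_ccvg _ (fun=> 0)); last exact: ccvg_cst.
  by move=> N; rewrite /series /= big1// => m _; rewrite mul0r.
have /(congr1 (fun u : nat -> R[i] => u n)) /= := E.
by move=> /eqP; rewrite mulf_eq0 pnatr_eq0 /= => /eqP.
Qed.

(** The dilates of f are uniform limits of polynomials, and they converge
    weakly to f. *)
Lemma dint_bergman_eq0 p q f g : conjugate p q -> 1 < q -> Lp q g ->
  (forall z, normc z < 1 -> dint (fun x => bker z (plane x) * g x) = 0) ->
  bergman p f -> dint (fun x => f (plane x) * g x) = 0.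
Proof.
move=> pq q1 lg h bf; have [p0 q0 _] := pq.
have jg := Lp_integrable q1 lg.
have mon := dint_monom_eq0 jg h.
have [af _] := iffLR (bergmanP f p0) bf; have [a ha] := analytic_pseries af.
apply: (ccvg_unique (dint_dilation_cvg pq bf lg)).
apply: (@eq_ccvg _ (fun=> 0)); last exact: ccvg_cst.
move=> n; have r0 := radius_gt0 R n; have r1 := radius_lt1 R n.
have hr := expands_dilation ha r0 (ltW r1).
have [s [M [s1 hM]]] := dilation_bounded ha r0 r1.
apply/esym/(ccvg_unique (dint_expands hr hM s1 jg)).
apply: (@eq_ccvg _ (fun=> 0)); last exact: ccvg_cst.
by move=> N; rewrite /series /= big1// => m _; rewrite mon mulr0.
Qed.

End Kernel.

(** * Functionals vanishing on a common kernel *)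

Section Span.
Variable R : realType.
Implicit Types (V : set (R[i] -> R[i])) (phi psi : (R[i] -> R[i]) -> R[i]).

Definition linear_on V phi := forall a f g, V f -> V g ->
  phi (fun z => a * f z + g z) = a * phi f + phi g.

Lemma linear_on_sum V N (phi : 'I_N -> (R[i] -> R[i]) -> R[i]) c :
  (forall i, linear_on V (phi i)) -> linear_on V (fun f => \sum_(i < N) c i * phi i f).
Proof.
move=> hphi a f g Vf Vg; rewrite mulr_sumr -big_split /=; apply: eq_bigr => i _.
by rewrite hphi// mulrDr mulrCA.
Qed.

(** By induction on N: restrict to the kernel of the first functional, where
    psi is a combination of the others, and correct by a multiple of the first. *)
Lemma span_of_common_kernel N (phi : 'I_N -> (R[i] -> R[i]) -> R[i]) psi V :
  (forall a f g, V f -> V g -> V (fun z => a * f z + g z)) ->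
  (forall i, linear_on V (phi i)) -> linear_on V psi ->
  (forall f, V f -> (forall i, phi i f = 0) -> psi f = 0) ->
  exists c, forall f, V f -> psi f = \sum_(i < N) c i * phi i f.
Proof.
elim: N phi psi V => [|N IH] phi psi V Vlin hphi hpsi h0.
  by exists (fun=> 0) => f Vf; rewrite big_ord0 h0// => -[].
pose V' := [set f | V f /\ phi ord0 f = 0].
have sub f : V' f -> V f by case.
have [||||c hc] := IH (fun i => phi (lift ord0 i)) psi V'.
- move=> a f g [Vf f0] [Vg g0]; split; first exact: Vlin.
  by rewrite hphi// f0 g0 mulr0 addr0.
- by move=> i a f g /sub Vf /sub Vg; exact: hphi.
- by move=> a f g /sub Vf /sub Vg; exact: hpsi.
- move=> f [Vf f0] h; apply: h0 => // i.
  by case: (unliftP ord0 i) => [j ->|->//].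
pose S f := \sum_(i < N) c i * phi (lift ord0 i) f.
have hS : linear_on V S by apply: linear_on_sum => i; exact: hphi.
suff [c0 hc0] : exists c0, forall f, V f -> psi f - S f = c0 * phi ord0 f.
  exists (fun i => oapp c c0 (unlift ord0 i)) => f Vf.
  rewrite big_ord_recl unlift_none /= -hc0//.
  by under eq_bigr do rewrite liftK /=; rewrite subrK.
have [z0|] := pselect (forall f, V f -> phi ord0 f = 0).
  by exists 0 => f Vf; rewrite mul0r hc ?subrr//; split => //; exact: z0.
move=> /existsNP[e] /not_implyP[Ve /eqP e0].
exists ((psi e - S e) / phi ord0 e) => f Vf.
pose a := - (phi ord0 f / phi ord0 e).
have V'f : V' (fun z => a * e z + f z).
  by split; [exact: Vlin|rewrite hphi// /a mulNr divfK// addNr].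
have := hc _ V'f; rewrite -/(S _) hpsi// hS// => E.
have : psi f - S f = - a * (psi e - S e).
  rewrite (_ : psi f = a * psi e + psi f - a * psi e); last by rewrite addrAC subrr add0r.
  by rewrite E; ring.
by move=> ->; rewrite /a opprK; ring.
Qed.

End Span.

(** * The first variation of the norm *)

Section Extremal.
Variable R : realType.
Local Notation mD := (@measurable_pdisc R).
Local Notation dint := (cint (sigma R) (@pdisc R)).
Local Notation dintegrable := (cintegrable (sigma R) (@pdisc R)).
Local Notation dmeas := (cmeas (@pdisc R)).
Implicit Types (p q : R) (f h : R[i] -> R[i]) (g u : R2 R -> R[i]) (w : R[i]).

(** The duality map of L^p: up to a factor, it sends g to the function of L^q
    that norms it. *)
Definition duality p w : R[i] := (normc w `^ (p - 1))%:C * csgn w.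

(** A form without division, for measurability and for continuity away from 0.
    At w = 0 the value of the power is immaterial. *)
Lemma dualityE p w : duality p w = (normc w `^ (p - 2))%:C * w.
Proof.
rewrite /duality /csgn; case: eqVneq => [->|w0]; first by rewrite !mulr0.
have nw : normc w != 0 by rewrite gt_eqF// normc_gt0.
have -> : p - 1 = (p - 2) + 1 by ring.
rewrite powRD ?nw ?implybT// powRr1 ?normc_ge0// rmorphM -mulrA; congr (_ * _).
by rewrite mulrC divfK//; apply/eqP => -[] /eqP; rewrite (negbTE nw).
Qed.

Lemma normc_duality p w : 1 < p -> normc (duality p w) = normc w `^ (p - 1).
Proof.
move=> p1; rewrite /duality normcM normc_real ger0_norm ?powR_ge0// /csgn.
case: eqVneq => [->|w0].
  by rewrite normc0 mulr0 powR0//; lra.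
rewrite normcM normcV normc_real ger0_norm ?normc_ge0// divff ?mulr1//.
by rewrite gt_eqF// normc_gt0.
Qed.

Lemma mul_conj_duality p w : 1 < p -> w * (duality p w)^* = (normc w `^ p)%:C.
Proof.
move=> p1; have [->|w0] := eqVneq w 0.
  by rewrite mul0r normc0 powR0//; lra.
have nw : normc w != 0 by rewrite gt_eqF// normc_gt0.
have ww : w * w^* = (normc w ^+ 2)%:C.
  by apply: eqcP; case: (w) => a b /=; rewrite ?sqr_sqrtr ?addr_ge0 ?sqr_ge0//; ring.
rewrite dualityE conjcM conjc_real mulrCA ww -rmorphM /=; congr (_%:C).
have -> : p = (p - 2) + 2%:R by ring.
by rewrite [RHS]powRD ?nw ?implybT// powR_mulrn ?normc_ge0// addrK.
Qed.

Lemma cmeas_duality p g : dmeas g -> dmeas (fun x => duality p (g x)).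
Proof.
move=> mg; under eq_fun do rewrite dualityE.
by apply: cmeasM => //; apply: cmeas_real; exact: measurable_normc_powR.
Qed.

Lemma conjugate_mulr p q : conjugate p q -> (p - 1) * q = p.
Proof.
move=> [p0 q0 pq]; have p00 : p != 0 by rewrite gt_eqF.
have q00 : q != 0 by rewrite gt_eqF.
have E : p * q = q + p by rewrite -[LHS]mul1r -pq; field; rewrite p00 q00.
by rewrite mulrBl mul1r E; ring.
Qed.

Lemma normc_duality_powR p q w : 1 < p -> conjugate p q ->
  normc (duality p w) `^ q = normc w `^ p.
Proof. by move=> p1 pq; rewrite normc_duality// -powRrM conjugate_mulr. Qed.

Lemma Lp_duality p q g : 1 < p -> conjugate p q -> Lp p g ->
  Lp q (fun x => duality p (g x)).
Proof.
move=> p1 pq [mg jg]; split; first exact: cmeas_duality.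
by under eq_fun do rewrite normc_duality_powR//.
Qed.

Lemma ccvg_duality p (u : nat -> R[i]) w : 1 < p -> ccvg u w ->
  ccvg (fun n => duality p (u n)) (duality p w).
Proof.
move=> p1 uw; have nu := ccvg_normc uw.
have [w0|w0] := eqVneq w 0.
  have -> : duality p w = 0 by rewrite dualityE w0 mulr0.
  apply: (@ccvg_squeeze _ _ _ (fun n => normc (u n) `^ (p - 1))).
    by move=> n; rewrite subr0 normc_duality.
  have p10 : p - 1 != 0 by rewrite gt_eqF// subr_gt0.
  rewrite -(powR0 p10) -(normc0 R) -w0.
  by apply: powR_cvg_pos => //; [lra|move=> n; exact: normc_ge0].
rewrite dualityE; under eq_fun do rewrite dualityE.
have nw : 0 < normc w by rewrite normc_gt0.
have cv : normc (u n) `^ (p - 2) @[n --> \oo] --> normc w `^ (p - 2).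
  exact: powR_cvg_gt0.
apply: (@ccvg_squeeze _ _ _ (fun n =>
   `|normc (u n) `^ (p - 2) - normc w `^ (p - 2)| * normc (u n) +
   normc w `^ (p - 2) * normc (u n - w))).
  move=> n; rewrite (_ : _ - _ = (normc (u n) `^ (p - 2) - normc w `^ (p - 2))%:C * u n +
     (normc w `^ (p - 2))%:C * (u n - w)); last by rewrite rmorphB /=; ring.
  apply: le_trans (le_normcD _ _) _.
  by rewrite !normcM !normc_real [X in _ + X * _]ger0_norm ?powR_ge0.
rewrite -(addr0 0); apply: cvgD.
  rewrite -(mul0r (normc w)); apply: cvgM => //.
  by rewrite -(normr0 R); apply: cvg_norm; exact/subr_cvg0.
by rewrite -(mulr0 (normc w `^ (p - 2))); apply: cvgM => //; exact: cvg_cst.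
Qed.

(** The p-th power of the norm, for which the extremal problem is the same. *)
Definition pmass p g := \int[sigma R]_(x in @pdisc R) (normc (g x) `^ p).

Lemma pmass_ge0 p g : 0 <= pmass p g.
Proof. by apply: Rintegral_ge0 => x _; exact: powR_ge0. Qed.

Lemma Re_dint_duality p g : 1 < p ->
  complex.Re (dint (fun x => g x * (duality p (g x))^*)) = pmass p g.
Proof. by move=> p1; apply: eq_Rintegral => x _; rewrite mul_conj_duality. Qed.

(** Young's inequality, integrated; [Re_dint_duality] is its case of equality. *)
Lemma Re_dint_young p q g u : 1 < p -> conjugate p q -> Lp p g -> Lp p u ->
  complex.Re (dint (fun x => g x * (duality p (u x))^*)) <= pmass p g / p + pmass p u / q.
Proof.
move=> p1 pq lg lu; have ld := Lp_conj (Lp_duality p1 pq lu).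
apply: le_trans (Re_cint_le mD (Lp_mul pq lg ld) (integrable_young lg ld) _) _.
  move=> x _; apply: le_trans (ler_norm _) _; apply: le_trans (Re_le_normc _) _.
  exact: young_normc.
have iZ (s c : R) v : Lp s v ->
    (sigma R).-integrable (@pdisc R) (EFin \o (fun x => c * normc (v x) `^ s)).
  by move=> [_ jv]; exact: (integrableZl mD c jv).
under eq_Rintegral do rewrite mulrC [X in _ + X]mulrC normc_conj normc_duality_powR//.
rewrite RintegralD; [|exact: mD|exact: iZ|exact: iZ].
rewrite !RintegralZl; [|exact: mD|exact: lu.2|exact: mD|exact: lg.2].
by rewrite mulrC [X in _ + X]mulrC.
Qed.

(** By [Re_dint_young], |g|^p <= |u|^p / p + |g|^p / q for the norms of L^p, and
    1/q = 1 - 1/p. *)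
Lemma pmass_le p q g u : 1 < p -> conjugate p q -> Lp p g -> Lp p u ->
  dint (fun x => u x * (duality p (g x))^*) = dint (fun x => g x * (duality p (g x))^*) ->
  pmass p g <= pmass p u.
Proof.
move=> p1 pq lg lu E; have := Re_dint_young p1 pq lu lg.
rewrite E Re_dint_duality//; have [p0 q0 pq1] := pq.
have -> : q^-1 = 1 - p^-1 by lra.
have pV : 0 < p^-1 by rewrite invr_gt0.
by move=> H; rewrite -(ler_pM2r pV); lra.
Qed.

(** With v = g + t u, [Re_dint_young] gives
    |v|^p = Re <v, J v> <= |g|^p / p + |v|^p / q + t Re <u, J v>, J being the
    duality map, so that minimality of g forces Re <u, J v> >= 0. Letting t tend
    to 0 avoids differentiating the norm. *)
Lemma first_variation_ge0 p q g u : 1 < p -> conjugate p q -> Lp p g -> Lp p u ->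
  (forall t : R, 0 < t -> pmass p g <= pmass p (fun x => t%:C * u x + g x)) ->
  0 <= complex.Re (dint (fun x => u x * (duality p (g x))^*)).
Proof.
move=> p1 pq lg lu hmin; have [p0 q0 pq1] := pq.
pose t n : R := n.+1%:R^-1.
have t0 n : 0 < t n by rewrite invr_gt0.
have t1 n : t n <= 1 by rewrite invf_le1// ler1n.
pose v n x := (t n)%:C * u x + g x.
have lv n : Lp p (v n) by apply: LpD; [exact: ltW|exact: LpZ|].
have ldv n := Lp_conj (Lp_duality p1 pq (lv n)).
have step n : 0 <= complex.Re (dint (fun x => u x * (duality p (v n x))^*)).
  have E : complex.Re (dint (fun x => g x * (duality p (v n x))^*)) +
      t n * complex.Re (dint (fun x => u x * (duality p (v n x))^*)) = pmass p (v n).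
    rewrite -Re_dint_duality//.
    have ju := Lp_mul pq lu (ldv n); have jg := Lp_mul pq lg (ldv n).
    rewrite (_ : t n * _ = complex.Re ((t n)%:C * dint (fun x => u x * (duality p (v n x))^*))).
      rewrite -cReD -cintZ; [|exact: mD|exact: ju].
      rewrite -cintD; [|exact: mD|exact: jg|apply: cintegrableZ; [exact: mD|exact: ju]].
      by congr complex.Re; apply: eq_cint => x _; rewrite /v; ring.
    by rewrite cReM /= mul0r subr0.
  have := Re_dint_young p1 pq lg (lv n); have := hmin _ (t0 n).
  rewrite -/(v n) -(pmulr_rge0 _ (t0 n)).
  have -> : q^-1 = 1 - p^-1 by lra.
  move=> h1 h2; have pV : 0 < p^-1 by rewrite invr_gt0.
  have : pmass p g / p <= pmass p (v n) / p by rewrite ler_pM2r.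
  move: E h2; set X := complex.Re _; set Y := t n * _; lra.
have ldg := Lp_conj (Lp_duality p1 pq lg).
have jw : (sigma R).-integrable (@pdisc R) (EFin \o (fun x =>
    normc (u x) `^ p / p + 2 `^ p * (normc (u x) `^ p + normc (g x) `^ p) / q)).
  have j1 := integrableZl mD p^-1 lu.2.
  have j2 := integrableZl mD (2 `^ p / q) (integrableD mD lu.2 lg.2).
  have := integrableD mD j1 j2; apply: eq_integrable; first exact: mD.
  by move=> x _ /=; congr EFin; rewrite mulrC; congr (_ + _); ring.
have h1 n : dmeas (fun x => u x * (duality p (v n x))^*).
  by apply: cmeasM; [case: lu|case: (ldv n)].
have h2 x : pdisc x -> ccvg (fun n => u x * (duality p (v n x))^*) (u x * (duality p (g x))^*).
  move=> _; apply: ccvgZ; apply: ccvg_conj; apply: ccvg_duality => //.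
  have h : ccvg (fun n => (t n)%:C) 0.
    rewrite /ccvg; under eq_fun do rewrite subr0 normc_real.
    by rewrite -(normr0 R); apply: cvg_norm; exact: cvg_harmonic.
  have := ccvgD (ccvgZ (u x) h) (ccvg_cst (g x)); rewrite mulr0 add0r.
  by apply: eq_ccvg => n; rewrite /v mulrC.
have h3 n x : pdisc x -> normc (u x * (duality p (v n x))^*) <=
    normc (u x) `^ p / p + 2 `^ p * (normc (u x) `^ p + normc (g x) `^ p) / q.
  move=> _; apply: le_trans (young_normc _ _ pq) _.
  rewrite lerD2l normc_conj normc_duality_powR// ler_wpM2r ?invr_ge0 ?(ltW q0)//.
  apply: le_trans (_ : (normc (u x) + normc (g x)) `^ p <= _); last first.
    by apply: powRD_le; rewrite ?normc_ge0// ltW.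
  apply: ge0_ler_powR; rewrite ?nnegrE ?addr_ge0 ?normc_ge0 ?(ltW p0)//.
  apply: le_trans (le_normcD _ _) _; rewrite lerD2r normcM normc_real gtr0_norm//.
  by rewrite ler_piMl ?normc_ge0.
have [_ cv] := cint_dominated_cvg mD h1 h2 h3 jw.
by apply: (cvgr_to_ge (ccvg_Re cv)); exact: nearW.
Qed.

Lemma bergman_normE p f : 0 < p -> bergman p f ->
  bergman_norm p f = (pmass p (fun x => f (plane x)) `^ p^-1)%:E.
Proof.
move=> p0 /(bergmanP _ p0)[_ [_ jf]]; rewrite /bergman_norm -poweR_EFin.
by rewrite /pmass /Rintegral fineK//; apply: integrable_fin_num jf; exact: mD.
Qed.

Lemma bergman_norm_le p f h : 0 < p -> bergman p f -> bergman p h ->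
  (bergman_norm p f <= bergman_norm p h)%E =
  (pmass p (fun x => f (plane x)) <= pmass p (fun x => h (plane x))).
Proof.
move=> p0 bf bh; rewrite !bergman_normE// lee_fin.
have pV : 0 < p^-1 by rewrite invr_gt0.
apply/idP/idP => [|le]; last by apply: ge0_ler_powR; rewrite ?nnegrE ?pmass_ge0// ltW.
by apply: contraTT; rewrite -!ltNge => lt; apply: gt0_ltr_powR; rewrite ?nnegrE ?pmass_ge0.
Qed.

(** The real part of c <h, G> is nonnegative for c = 1, -1, i and -i. *)
Lemma extremal_orthogonal p q f (V : set (R[i] -> R[i])) : 1 < p -> conjugate p q ->
  bergman p f -> (forall h, V h -> bergman p h) ->
  (forall c h, V h -> V (fun z => c * h z)) ->
  (forall h, V h -> pmass p (fun x => f (plane x)) <= pmass p (fun x => h (plane x) + f (plane x))) ->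
  forall h, V h -> dint (fun x => h (plane x) * (duality p (f (plane x)))^*) = 0.
Proof.
move=> p1 pq bf Vb VZ hmin h Vh; have [p0 q0 _] := pq.
have [_ lf] := iffLR (bergmanP _ p0) bf.
have ge0 k : V k -> 0 <= complex.Re (dint (fun x => k (plane x) * (duality p (f (plane x)))^*)).
  move=> Vk; have [_ lk] := iffLR (bergmanP _ p0) (Vb _ Vk).
  apply: (first_variation_ge0 p1 pq lf lk) => t t0.
  exact: (hmin (fun z => t%:C * k z) (VZ _ _ Vk)).
have [_ lh] := iffLR (bergmanP _ p0) (Vb _ Vh).
have ld := Lp_conj (Lp_duality p1 pq lf).
have jh := Lp_mul pq lh ld.
have cE c : 0 <= complex.Re (c * dint (fun x => h (plane x) * (duality p (f (plane x)))^*)).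
  rewrite -cintZ; [|exact: mD|exact: jh].
  have := ge0 _ (VZ c _ Vh); congr (_ <= complex.Re _).
  by apply: eq_cint => x _; rewrite mulrA.
apply: eqcP => /=.
- have := cE 1; have := cE (-1); rewrite !cReM /=; lra.
- have := cE 'i; have := cE (- 'i); rewrite !cReM /=; lra.
Qed.

End Extremal.

(** * The characterization of extremal functions *)

Theorem theorem2p4 (R : realType) (p q : R) (hp : 1 < p)
  (hpq : p^-1 + q^-1 = 1) (N : nat) (hN : (0 < N)%N)
  (phi : 'I_N -> (R[i] -> R[i]) -> R[i])
  (hphi : forall i, bergman_dual p (phi i))
  (hind : lin_indep p phi)
  (k : 'I_N -> R[i] -> R[i])
  (hk : forall i, is_kernel p q (phi i) (k i))
  (F : R[i] -> R[i]) (hF : bergman p F) :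
  bergman_norm p F =
    ereal_inf [set bergman_norm p f | f in
                 [set f | bergman p f /\ forall i, phi i f = phi i F]]
  <->
  exists c : 'I_N -> R[i], forall z, disc z ->
    bergman_proj (fun w => (normc (F w) `^ (p - 1))%:C * csgn (F w)) z
      = \sum_(i < N) c i * k i z.
Proof.
have p0 : 0 < p by lra.
have q1 : 1 < q.
  have qV : 0 < q^-1 by rewrite -(ltrD2l p^-1) hpq addr0 invf_lt1.
  have q0 : 0 < q by rewrite -invr_gt0.
  by rewrite -(invf_lt1 q0) -(ltrD2l p^-1) hpq ltrDr invr_gt0.
have q0 : 0 < q by lra.
have pq : conjugate p q by [].
have qp : conjugate q p by split => //; rewrite addrC.
have mD := @measurable_pdisc R.
pose dint := @cint _ _ R (sigma R) (@pdisc R).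
pose G x := duality p (F (plane x)).
have [aF lF] := iffLR (bergmanP _ p0) hF.
have lG : Lp q G := Lp_duality hp pq lF.
have bk i : bergman q (k i) := (hk i).1.
have lk i : Lp q (fun x => k i (plane x)) := (iffLR (bergmanP _ q0) (bk i)).2.
have phiE i f : bergman p f -> phi i f = dint (fun x => f (plane x) * (k i (plane x))^*).
  by move=> bf; exact: (hk i).2.
have lb f : bergman p f -> Lp p (fun x => f (plane x)).
  by move=> /(bergmanP _ p0)[].
have projG z : bergman_proj (fun w => (normc (F w) `^ (p - 1))%:C * csgn (F w)) z =
    dint (fun x => G x * (bker z (plane x))^*) by rewrite bergman_projE.
have minE : bergman_norm p F = ereal_inf [set bergman_norm p f | f in
                 [set f | bergman p f /\ forall i, phi i f = phi i F]] <->
    forall f, bergman p f -> (forall i, phi i f = phi i F) ->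
      pmass p (fun x => F (plane x)) <= pmass p (fun x => f (plane x)).
  split => [E f bf hf|H].
    rewrite -bergman_norm_le// E; apply: ereal_inf_lbound.
    by exists f.
  apply/eqP; rewrite eq_le; apply/andP; split.
    by apply: le_ereal_inf_tmp => _ [f [bf hf] <-]; rewrite bergman_norm_le//; exact: H.
  by apply: ereal_inf_lbound; exists F.
have linphi i : linear_on (bergman p) (phi i) by case: (hphi i).
have linG : linear_on (bergman p) (fun h => dint (fun x => h (plane x) * (G x)^*)).
  move=> a f h bf bh.
  have jf := Lp_mul pq (lb _ bf) (Lp_conj lG); have jh := Lp_mul pq (lb _ bh) (Lp_conj lG).
  rewrite /dint -cintZ// -cintD//; last exact: cintegrableZ.
  by apply: eq_cint => x _; rewrite mulrDl mulrA.
have conj_dint z g : Lp q g -> disc z ->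
    dint (fun x => bker z (plane x) * (g x)^*) = (dint (fun x => g x * (bker z (plane x))^*))^*.
  move=> lg z1; rewrite /dint -cint_conj//; last first.
    exact: (Lp_mul qp lg (Lp_bker_conj p0 z1)).
  by apply: eq_cint => x _; rewrite conjcM conjcK mulrC.
split.
- move=> /minE hmin.
  (* the admissible variations of F *)
  pose V := [set h | bergman p h /\ forall i, phi i h = 0].
  have Vb h : V h -> bergman p h by case.
  have VZ c h : V h -> V (fun z => c * h z).
    move=> [bh h0]; have E : (fun z => c * h z) = (fun z => (c - 1) * h z + h z).
      by apply/funext => z; ring.
    rewrite E; split; first exact: bergman_lincomb.
    by move=> i; rewrite (linphi i)// h0 mulr0 addr0.
  have Vmin h : V h -> pmass p (fun x => F (plane x)) <=
      pmass p (fun x => h (plane x) + F (plane x)).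
    move=> [bh h0]; have E : (fun z => h z + F z) = (fun z => 1 * h z + F z).
      by apply/funext => z; rewrite mul1r.
    apply: (hmin (fun z => h z + F z)); first by rewrite E; exact: bergman_lincomb.
    by move=> i; rewrite E (linphi i)// h0 mulr0 add0r.
  have orth := extremal_orthogonal hp pq hF Vb VZ Vmin.
  have [||||c hc] := @span_of_common_kernel R N phi
      (fun h => dint (fun x => h (plane x) * (G x)^*)) (bergman p).
  + by move=> a f h; exact: bergman_lincomb.
  + exact: linphi.
  + exact: linG.
  + by move=> f bf f0; exact: orth.
  exists (fun i => (c i)^*) => z z1.
  rewrite projG -[LHS]conjcK -conj_dint// hc; last exact: bergman_bker.
  rewrite rmorph_sum /=; apply: eq_bigr => i _.
  rewrite conjcM; congr (_ * _); rewrite phiE; last exact: bergman_bker.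
  by rewrite conj_dint// conjcK; exact: (bergman_reproducing qp (bk i) z1).
- move=> [c hc]; apply/minE => f bf hf.
  (* G - K has Bergman projection 0, so it annihilates A^p. *)
  pose K x := \sum_(i < N) c i * k i (plane x).
  have lK : Lp q K by exact: Lp_sum.
  pose g x := (G x)^* - (K x)^*.
  have lg : Lp q g.
    have := LpD (ltW q0) (Lp_conj lG) (LpZ (-1) (Lp_conj lK)).
    by under eq_fun do rewrite mulN1r.
  have g0 z : normc z < 1 -> dint (fun x => bker z (plane x) * g x) = 0.
    move=> z1; have lz := lb _ (bergman_bker p0 z1).
    have lzq := Lp_bker_conj p0 z1.
    rewrite /g (_ : (fun x => _) = (fun x => bker z (plane x) * (G x)^* - bker z (plane x) * (K x)^*)); last first.
      by apply/funext => x; rewrite mulrBr.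
    rewrite /dint cintB//; [|exact: (Lp_mul pq lz (Lp_conj lG))|exact: (Lp_mul pq lz (Lp_conj lK))].
    rewrite -/dint !conj_dint// -projG hc//.
    have -> : dint (fun x => K x * (bker z (plane x))^*) = \sum_(i < N) c i * k i z.
      transitivity (dint (fun x => \sum_(i < N) c i * (k i (plane x) * (bker z (plane x))^*))).
        by apply: eq_cint => x _; rewrite /K mulr_suml; apply: eq_bigr => i _; rewrite mulrA.
      have ji i := Lp_mul qp (lk i) lzq.
      rewrite /dint cint_sum//; last by move=> i; exact: cintegrableZ.
      by apply: eq_bigr => i _; rewrite cintZ// (bergman_reproducing qp (bk i) z1).
    by rewrite subrr.
  have ann h : bergman p h -> dint (fun x => h (plane x) * (G x)^*) = \sum_(i < N) (c i)^* * phi i h.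
    move=> bh; have lh := lb _ bh.
    have := dint_bergman_eq0 pq q1 lg g0 bh.
    rewrite (_ : (fun x => _) = (fun x => h (plane x) * (G x)^* - h (plane x) * (K x)^*)); last first.
      by apply/funext => x; rewrite mulrBr.
    rewrite cintB//; [|exact: (Lp_mul pq lh (Lp_conj lG))|exact: (Lp_mul pq lh (Lp_conj lK))].
    move=> /eqP; rewrite subr_eq0 => /eqP; rewrite -/dint => ->.
    transitivity (dint (fun x => \sum_(i < N) (c i)^* * (h (plane x) * (k i (plane x))^*))).
      apply: eq_cint => x _; rewrite /K rmorph_sum mulr_sumr; apply: eq_bigr => i _ /=.
      by rewrite conjcM mulrCA.
    have ji i := Lp_mul pq lh (Lp_conj (lk i)).
    rewrite /dint cint_sum//; last by move=> i; exact: cintegrableZ.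
    by apply: eq_bigr => i _; rewrite cintZ// phiE.
  apply: (pmass_le hp pq lF (lb _ bf)).
  rewrite -/dint ann// ann//; apply: eq_bigr => i _; by rewrite hf.
Qed.
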